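(* Let $\lambda(N)$, $N=1,2,\dots$, be a sequence of signatures, $\lambda(N)$ of size $N$. Suppose that there exists a nonconstant piecewise-differentiable weakly decreasing function $f:[0,1]\to\mathbb R$ such that $\sum_{i=1}^N\left|\frac{\lambda_i(N)}N-f(i/N)\right|=o(\sqrt N)$ as $N\to\infty$ and $\sup_{i,N}|\lambda_i(N)/N|<\infty$. Let $$E(f)=\int_0^1f(t)\,dt,\qquad S(f)=\int_0^1f(t)^2\,dt-E(f)^2+\int_0^1f(t)(1-2t)\,dt.$$ Then for any $k$ and any $k$ reals $h_1,\dots,h_k$, $$\lim_{N\to\infty}\frac{s_{\lambda(N)}\Bigl(e^{h_1/\sqrt{NS(f)}},\dots,e^{h_k/\sqrt{NS(f)}},1^{N-k}\Bigr)}{s_{\lambda(N)}(1^N)}\exp\left(-\sqrt N\frac{E(f)}{\sqrt{S(f)}}(h_1+\cdots+h_k)\right)=\exp\left(\frac12(h_1^2+\cdots+h_k^2)\right).$$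
   Context: A signature of size $N$ is an $N$-tuple of integers $\lambda_1\ge\cdots\ge\lambda_N$. The Schur function is the symmetric Laurent polynomial $s_\lambda(u_1,\dots,u_N)=\det[u_i^{\lambda_j+N-j}]_{i,j=1}^N/\prod_{i<j}(u_i-u_j)$ (extended to coinciding arguments); $1^m$ stands for $m$ arguments equal to $1$. For nonconstant weakly decreasing $f$ one has $S(f)>0$.
   Formalization: ''Nonconstant'' is taken to mean nonconstant on the open interval (0,1): a weakly decreasing f that changes value only at an endpoint, e.g. f(0)=1 and f=0 on (0,1], has S(f)=0, so the formula would divide by zero. *)

(* Defs.v *)
From HB Require Import structures.
From mathcomp Require Import all_boot all_order all_algebra.
From mathcomp Require Import all_classical all_reals all_analysis.

Set Implicit Arguments.
Unset Strict Implicit.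
Unset Printing Implicit Defensive.

Import Order.TTheory GRing.Theory Num.Theory.
Import numFieldNormedType.Exports.

Local Open Scope classical_set_scope.
Local Open Scope ring_scope.

(* Indices run over 'I_N, so [lam i] stands for lambda_(i+1). *)
Definition signature (N : nat) (lam : 'I_N -> int) : Prop :=
  forall i j : 'I_N, (i <= j)%N -> lam j <= lam i.

Section Schur.
Context {R : realType}.

Definition schur_ratio (N : nat) (lam : 'I_N -> int) (u : 'rV[R]_N) : R :=
  \det (\matrix_(i < N, j < N) u 0 i ^ (lam j + (N - j.+1)%N%:Z)) /
  \prod_(i < N) \prod_(j < N | (i < j)%N) (u 0 i - u 0 j).

(* The Schur function extends [schur_ratio] to coinciding arguments by
   continuity: the limit is taken along points with pairwise distinct
   coordinates.  It is the value of the Laurent polynomial at every [u] with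
   nonzero coordinates. *)
Definition schur (N : nat) (lam : 'I_N -> int) (u : 'rV[R]_N) : R :=
  lim (schur_ratio lam v
         @[v --> within [set v : 'rV[R]_N | injective (v 0)] (nbhs u)]).

(* (x_1, ..., x_k, 1^(N-k)) for k <= N; truncated when N < k. *)
Definition pad1 (N : nat) (x : seq R) : 'rV[R]_N := \row_(i < N) nth 1 x i.

End Schur.

Section Profile.
Context {R : realType}.
Implicit Type f : R -> R.

Definition weakly_decreasing f : Prop :=
  {in `[0, 1] &, forall x y, x <= y -> f y <= f x}.

(* Nonconstancy is required on the open interval: a decreasing f that is
   constant on ]0, 1[ and jumps only at an endpoint has S(f) = 0. *)
Definition nonconstant f : Prop :=
  exists x y, [/\ x \in `]0, 1[, y \in `]0, 1[ & f x != f y].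

(* Differentiable off finitely many breakpoints, where f may be
   discontinuous. *)
Definition piecewise_differentiable f : Prop :=
  exists s : seq R,
    forall x, x \in `]0, 1[ -> x \notin s -> derivable f x 1.

Definition Ef f : R := \int[lebesgue_measure]_(t in `[0, 1]) f t.

Definition Sf f : R :=
  \int[lebesgue_measure]_(t in `[0, 1]) (f t ^+ 2) - Ef f ^+ 2
  + \int[lebesgue_measure]_(t in `[0, 1]) (f t * (1 - 2 * t)).

End Profile.

(* Main.v *)
(* Branching: s_lam(x, x') / s_lam(1) is a weighted sum of s_mu(x') / s_mu(1)
   over the signatures mu interlacing lam, with positive weights whose sum is
   the one-variable quotient s_lam(x, 1, ..) / s_lam(1).  Every such mu
   differs from lam by O(N) in l1-norm, hence has the same limit profile, so
   that the k-variable limit follows from the case k = 1 and from the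
   (k-1)-variable limit taken uniformly in mu.

   For k = 1 put l_i = lam_i + N - i.  Peeling off one variable at a time
   expresses the quotient through det[x^(l_j); binomial(l_j, i)], and
   expanding x = e^y in powers of y gives
     s_lam(e^y, 1, ..) / s_lam(1)
       = (y / (e^y - 1))^(N-1) sum_m y^m h_m(l) (N-1)! / (m+N-1)!.
   Centre l, so that p_1 = 0.  For y = c / sqrt N, Newton's identities
   m h_m = sum_j p_j h_(m-j) show that only p_2 ~ N^3 Var(f(t) + 1 - t)
   survives, and the series tends to exp(c^2 Var(f(t) + 1 - t) / 2).  The
   prefactor is read off from the case lam = 0, where the quotient is 1, and
   S(f) = Var(f(t) + 1 - t) - Var(1 - t). *)

(* A rate of convergence is needed only for the mean. The exponent contains y |lambda| / N with y of
   order 1 / sqrt N, so |lambda| / N^2 must be within o(1 / sqrt N) of E(f). This is what an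
   l1-error o(sqrt N) gives; for the variance plain convergence suffices. The loss of O(1) in the
   l1-error of lambda / N caused by one branching step is therefore harmless. Uniformity in mu would
   have to be carried through k nested steps. Instead, every limit is taken along an arbitrary
   filter on an arbitrary type: the induction hypothesis is applied to a filter on pairs (t, mu),
   and nothing has to be proved uniform by hand. Passing to the limit termwise in the series over m
   requires a majorant independent of N. Newton's recursion provides one: for centred points of size
   O(N), the rescaled power sums decay geometrically with a ratio of order |y|, which tends to 0,
   and this forces a bound K / 2^m on the rescaled h_m. *)
Require Import Defs.
From HB Require Import structures.
From mathcomp Require Import all_boot all_order all_algebra.
From mathcomp Require Import all_fingroup.
From mathcomp Require Import all_classical all_reals all_analysis.
From mathcomp Require Import measurable_realfun.
From mathcomp Require Import ring lra zify.

Set Implicit Arguments.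
Unset Strict Implicit.
Unset Printing Implicit Defensive.

Import Order.TTheory GRing.Theory Num.Theory.
Import numFieldNormedType.Exports.

Local Open Scope classical_set_scope.
Local Open Scope ring_scope.

(** * Branching of alternants *)

(* A signature of size n is coded by a function on nat of which only the
   values below n matter: sizes will vary along a filter, and this avoids
   dependent types. *)
Definition gap (lam : nat -> int) (j : nat) : nat := `|lam j - lam j.+1|%N.

(** One bound for all gaps makes the families of shifts a finite type; [interlacing] then restricts
    each coordinate to its own gap. *)
Definition gap_bound (n : nat) (lam : nat -> int) : nat :=
  (\max_(j < n) gap lam j).+1.

(* The entries of the signatures interlacing lam are lam_(j+1) + d_j with
   0 <= d_j <= gap lam j. *)
Definition lowering (n K : nat) (lam : nat -> int) (d : {ffun 'I_n -> 'I_K})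
    (j : nat) : int :=
  lam j.+1 + (oapp (fun i : 'I_n => d i : nat) 0%N (insub j))%:Z.

Definition interlacing (n : nat) (lam : nat -> int) :
    {pred {ffun 'I_n -> 'I_(gap_bound n lam)}} :=
  family (fun j : 'I_n => [pred e : 'I_(gap_bound n lam) | (e <= gap lam j)%N]).

Arguments interlacing : clear implicits.

Definition is_sig (n : nat) (lam : nat -> int) : Prop :=
  forall j, (j.+1 < n)%N -> lam j.+1 <= lam j.

Definition weight (n : nat) (lam : nat -> int) : int := \sum_(i < n) lam i.

Definition shifted (n : nat) (lam : nat -> int) (j : nat) : int :=
  lam j + (n - j.+1)%N%:Z.

Lemma lowering_ord n K lam (d : {ffun 'I_n -> 'I_K}) (j : 'I_n) :
  lowering lam d j = lam j.+1 + (d j)%:Z.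
Proof. by rewrite /lowering valK. Qed.

Lemma gap_lt n lam (j : 'I_n) : (gap lam j < gap_bound n lam)%N.
Proof. by rewrite /gap_bound ltnS (leq_bigmax j). Qed.

Lemma gapE n lam j : is_sig n lam -> (j.+1 < n)%N -> (gap lam j)%:Z = lam j - lam j.+1.
Proof. by move=> ls jn; rewrite /gap gez0_abs // subr_ge0 ls. Qed.

Lemma interlacingP n lam (d : {ffun 'I_n -> 'I_(gap_bound n lam)}) :
  reflect (forall j : 'I_n, (d j <= gap lam j)%N) (d \in interlacing n lam).
Proof. by apply: (iffP forallP) => H j; have := H j; rewrite inE. Qed.

Lemma lowering_bounds n lam (d : {ffun 'I_n -> 'I_(gap_bound n lam)}) j :
  is_sig n.+1 lam -> d \in interlacing n lam -> (j < n)%N ->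
  lam j.+1 <= lowering lam d j <= lam j.
Proof.
move=> ls /interlacingP Hd jn; rewrite (lowering_ord lam d (Ordinal jn)).
by have := Hd (Ordinal jn); have := @gapE _ _ j ls jn => /=; lia.
Qed.

Lemma is_sig_lowering n lam (d : {ffun 'I_n -> 'I_(gap_bound n lam)}) :
  is_sig n.+1 lam -> d \in interlacing n lam -> is_sig n (lowering lam d).
Proof.
move=> ls Hd j jn.
have /andP[_ h1] := lowering_bounds ls Hd jn.
have /andP[h2 _] := lowering_bounds ls Hd (ltnW jn).
exact: le_trans h1 h2.
Qed.

Section Branching.
Variable R : fieldType.

(* Column [j] minus [t ^ (l_j - l_{j+1})] times column [j+1] kills the first
   row except for its last entry; what remains telescopes in each column. *)
Lemma det_peel n (lam : nat -> int) (t : R) (psi : 'I_n -> int -> R) :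
  is_sig n.+1 lam -> t != 0 ->
  \det (\matrix_(i < n.+1, j < n.+1)
     oapp (psi^~ (shifted n.+1 lam j)) (t ^ shifted n.+1 lam j) (unlift ord0 i))
  = (-1) ^+ n * \sum_(d in interlacing n lam)
      t ^ (weight n.+1 lam - weight n (lowering lam d)) *
      \det (\matrix_(i < n, j < n)
         (psi i (shifted n (lowering lam d) j + 1)
          - t * psi i (shifted n (lowering lam d) j))).
Proof.
move=> ls t0; set A := \matrix_(i, j) _.
(* Right multiplication by the unipotent [U] performs the column operation without changing the
   determinant. *)
pose U := \matrix_(i < n.+1, j < n.+1)
  ((i == j)%:R - (i == j.+1 :> nat)%:R * t ^ (gap lam j).+1%:Z : R).
have detU : \det U = 1.
  rewrite det_trig; last first.
    apply/is_trig_mxP => i j ij; rewrite mxE -val_eqE /=.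
    by rewrite !(ltn_eqF _) //= ?mul0r ?subrr // ltnW.
  by rewrite big1 // => i _; rewrite mxE eqxx (ltn_eqF (ltnSn i)) mul0r subr0.
have AUE i j : (A *m U) i j = A i j -
    (if (j < n)%N then A i (inord j.+1) * t ^ (gap lam j).+1%:Z else 0).
  rewrite mxE (eq_bigr (fun k => A i k * (k == j)%:R
     - A i k * ((k == j.+1 :> nat)%:R * t ^ (gap lam j).+1%:Z))); last first.
    by move=> k _; rewrite [U _ _]mxE mulrBr.
  rewrite sumrB; congr (_ - _).
    rewrite (bigD1 j) //= eqxx mulr1 big1 ?addr0 // => k /negPf ->.
    by rewrite mulr0.
  case: ltnP => jn.
    rewrite (bigD1 (inord j.+1)) //= inordK // eqxx mul1r big1 ?addr0 // => k.
    rewrite -val_eqE /= inordK // => /negPf ->; by rewrite mul0r mulr0.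
  rewrite big1 // => k _; rewrite (ltn_eqF _) ?mul0r ?mulr0 //.
  by rewrite (leq_trans (ltn_ord k)).
have shE j : (j < n)%N -> shifted n.+1 lam j = shifted n.+1 lam j.+1 + (gap lam j).+1%:Z.
  by move=> jn; have := gapE ls (jn : j.+1 < n.+1)%N; rewrite /shifted; lia.
rewrite -[LHS]mulr1 -[X in _ * X]detU -det_mulmx (expand_det_row _ ord0) big_ord_recr /=.
rewrite big1 ?add0r; last first.
  move=> i _; rewrite AUE /= ltn_ord !mxE unlift_none /= inordK ?ltnS //.
  by rewrite shE // exprzDr ?unitfE // subrr mul0r.
rewrite AUE ltnn subr0 mxE unlift_none /= /cofactor add0n mulrCA; congr (_ * _).
rewrite -[X in _ * X = _]det_tr [X in _ * X = _]/determinant mulr_sumr.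
(* Entry (i, j) of the reduced minor is the sum of [G i j e] over 0 <= e <= gap, so that choosing
   one e in each column amounts to choosing an interlacing signature. *)
pose G i j (e : nat) : R := t ^ ((gap lam j)%:Z - e%:Z) *
  (psi i (shifted n.+1 lam j.+1 + e%:Z + 1) - t * psi i (shifted n.+1 lam j.+1 + e%:Z)).
have entry (i j : 'I_n) : (row' ord0 (col' ord_max (A *m U)))^T j i
    = \sum_(e < gap_bound n lam | (e <= gap lam j)%N) G i j e.
  transitivity (\sum_(e < (gap lam j).+1) G i j e); last first.
    by rewrite (big_ord_widen _ (G i j) (gap_lt lam j)).
  rewrite mxE [LHS]mxE [LHS]mxE.
  rewrite -(big_mkord predT (G i j)).
  (* [FF] runs between the two terms of the entry: t^(gap+1) psi(l_(j+1)) at e = 0 and psi(l_j) at e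
     = gap + 1. *)
  pose FF e := t ^ ((gap lam j).+1%:Z - e%:Z) * psi i (shifted n.+1 lam j.+1 + e%:Z).
  rewrite (eq_big_nat _ _ (F2 := fun e => FF e.+1 - FF e)); last first.
    move=> e _; rewrite /G /FF mulrBr; congr (_ * psi i _ - _);
      first by congr (_ ^ _); lia.
      by lia.
    rewrite mulrA; congr (_ * _).
    have -> : (gap lam j).+1%:Z - e%:Z = ((gap lam j)%:Z - e%:Z) + 1 by lia.
    by rewrite [RHS]exprzDr ?unitfE.
  rewrite telescope_sumr // /FF subrr expr0z mul1r subr0 addr0.
  rewrite (AUE (lift ord0 i)).
  set J := lift ord_max _; have lj : J = j :> nat by exact: lift_max.
  rewrite lj ltn_ord !mxE !liftK lj /= inordK ?ltnS //.
  by rewrite shE // mulrC.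
transitivity (\sum_(s : 'S_n) \sum_(d in interlacing n lam)
    t ^ shifted n.+1 lam n * ((-1) ^+ s * \prod_j G (s j) j (d j))).
  apply: eq_bigr => s _; rewrite -!mulr_sumr; congr (_ * (_ * _)).
  transitivity (\prod_(j < n) \sum_(e < gap_bound n lam | (e <= gap lam j)%N)
      G (s j) j e); first by apply: eq_bigr => j _; exact: entry.
  exact: bigA_distr_big_dep.
rewrite exchange_big /=; apply: eq_bigr => d /interlacingP Hd.
rewrite -det_tr /determinant mulr_sumr; apply: eq_bigr => s _.
rewrite mulrCA [RHS]mulrCA; congr (_ * _).
under [in RHS]eq_bigr => j _ do rewrite !mxE.
have shl (j : 'I_n) : shifted n (lowering lam d) j = shifted n.+1 lam j.+1 + (d j)%:Z.
  by rewrite /shifted lowering_ord subSS; lia.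
have -> : \prod_(j < n) G (s j) j (d j) = \prod_(j < n) t ^ ((gap lam j)%:Z - (d j)%:Z) *
    \prod_(j < n) (psi (s j) (shifted n (lowering lam d) j + 1) -
       t * psi (s j) (shifted n (lowering lam d) j)).
  by rewrite -big_split; apply: eq_bigr => j _; rewrite /G shl.
rewrite mulrA; congr (_ * _).
have -> : \prod_(j < n) t ^ ((gap lam j)%:Z - (d j)%:Z)
    = t ^ (\sum_(j < n) ((gap lam j)%:Z - (d j)%:Z)).
  elim/big_rec2: _ => [|j a b _ ->]; first by rewrite expr0z.
  by rewrite [RHS]exprzDr ?unitfE.
rewrite -exprzDr ?unitfE //; congr (_ ^ _).
rewrite /weight big_ord_recr /= /shifted subnn addr0 [RHS]addrAC -sumrB [LHS]addrC.
congr (_ + _); apply: eq_bigr => j _; rewrite lowering_ord.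
by have := gapE ls (ltn_ord j : j.+1 < n.+1)%N; lia.
Qed.
End Branching.

(* Sum over Gelfand-Tsetlin patterns with top row lam, where u 0 marks the
   weight |lam| - |mu| of the first step: this is the Schur function. *)
Fixpoint GT (R : unitRingType) (n : nat) (lam : nat -> int) (u : nat -> R) : R :=
  if n is n'.+1 then
    \sum_(d in interlacing n' lam)
      u 0%N ^ (weight n lam - weight n' (lowering lam d))
      * GT n' (lowering lam d) (fun i => u i.+1)
  else 1.

Lemma GTS (R : unitRingType) n lam (u : nat -> R) :
  GT n.+1 lam u = \sum_(d in interlacing n lam)
      u 0%N ^ (weight n.+1 lam - weight n (lowering lam d))
      * GT n (lowering lam d) (fun i => u i.+1).
Proof. by []. Qed.

Definition cons_var (R : Type) (x : R) (w : nat -> R) (i : nat) : R :=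
  if i is i'.+1 then w i' else x.

Definition first_var (R : unitRingType) (x : R) : nat -> R := cons_var x (fun=> 1).

(** Induction by [det_peel] with [psi] the powers of the remaining variables: row i acquires the
    factor u_(i+1) - u_0, and these factors supply the part of the Vandermonde product that involves
    u_0. *)
Lemma alternant_GT (R : fieldType) n lam (u : nat -> R) :
  is_sig n lam -> (forall i, (i < n)%N -> u i != 0) ->
  \det (\matrix_(i < n, j < n) u i ^ shifted n lam j)
  = GT n lam u * \prod_(i < n) \prod_(j < n | (i < j)%N) (u i - u j).
Proof.
elim: n lam u => [|n IH] lam u ls un0.
  by rewrite det_mx00 /= big_ord0 mulr1.
pose psi (i : 'I_n) (l : int) := u i.+1 ^ l.
have := det_peel psi ls (un0 0%N isT).
rewrite (_ : \matrix_(i, j) oapp _ _ _ =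
  \matrix_(i < n.+1, j < n.+1) u i ^ shifted n.+1 lam j); last first.
  apply/matrixP => i j; rewrite !mxE; case: unliftP => [i' ->|->] //=.
move=> ->.
rewrite GTS big_ord_recl /= mulr_suml mulr_sumr; apply: eq_bigr => d Hd.
pose c := \row_(i < n) (u i.+1 - u 0%N).
rewrite (_ : \matrix_(i, j) _ = diag_mx c *m
   \matrix_(i < n, j < n) u i.+1 ^ shifted n (lowering lam d) j); last first.
  apply/matrixP => i j; rewrite mul_diag_mx !mxE /psi.
  rewrite exprzDr ?unitfE ?un0 ?ltnS // expr1z mulrBl mulrC; congr (_ - _).
rewrite det_mulmx det_diag (IH (lowering lam d) (fun i => u i.+1)); last 2 first.
- exact: is_sig_lowering.
- by move=> i lin; rewrite un0.
have -> : \prod_(i < n) c 0 i = (-1) ^+ n * \prod_(i < n) (u 0%N - u i.+1).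
  rewrite -[n in (-1) ^+ n]card_ord -prodr_const -big_split /=.
  by apply: eq_bigr => i _; rewrite mxE mulN1r opprB.
set A := \prod_(i < n) (u 0%N - u i.+1); set X := u 0%N ^ _; set g := GT _ _ _.
set B := (X in _ * (_ * (_ * (_ * X))) = _).
set C := (X in _ = _ * (X * _)); set D := (X in _ = _ * (_ * X)).
have -> : C = A by rewrite /C big_mkcond big_ord_recl /= mul1r.
have -> : D = B.
  apply: eq_bigr => i _; rewrite big_mkcond big_ord_recl /= mul1r [RHS]big_mkcond.
  by apply: eq_bigr => j.
transitivity (((-1) ^+ n) ^+ 2 * (X * (A * (g * B)))); first by ring.
by rewrite sqrr_sign; ring.
Qed.

Lemma GT_gt0 (R : numFieldType) n lam (u : nat -> R) :
  (forall i, (i < n)%N -> 0 < u i) -> 0 < GT n lam u.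
Proof.
elim: n lam u => [|n IH] lam u u0 //=.
(* The zero shift always qualifies, since [gap] is an absolute value: the sum is nonempty even when
   [lam] is not a signature. *)
pose d0 : {ffun 'I_n -> 'I_(gap_bound n lam)} := [ffun=> ord0].
have Hd0 : d0 \in interlacing n lam by apply/interlacingP => j; rewrite ffunE.
have pos d : 0 < u 0%N ^ (weight n.+1 lam - weight n (@lowering n (gap_bound n lam)
  lam d))
      * GT n (lowering lam d) (fun i => u i.+1).
  by rewrite mulr_gt0 ?exprz_gt0 ?u0 // IH // => i lin; rewrite u0.
rewrite (bigD1 d0) //= ltr_pwDl ?pos // sumr_ge0 // => d _.
exact/ltW/pos.
Qed.

(** * Determinants of binomial polynomials *)

Section Binomial.
Variable R : numFieldType.

Definition binpoly (i : nat) : {poly R} :=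
  (i`!%:R)^-1 *: \prod_(k < i) ('X - k%:R%:P).

Definition binz (i : nat) (l : int) : R := (binpoly i).[l%:~R].

Lemma binzE i l : binz i l = (\prod_(k < i) (l%:~R - k%:R)) / i`!%:R.
Proof.
rewrite /binz hornerZ mulrC horner_prod; congr (_ * _).
by apply: eq_bigr => k _; rewrite hornerXsubC.
Qed.

Lemma binz0 l : binz 0 l = 1.
Proof. by rewrite binzE big_ord0 divr1. Qed.

Lemma binzS i l : binz i.+1 (l + 1) = binz i.+1 l + binz i l.
Proof.
rewrite !binzE big_ord_recl [X in _ = X / _ + _]big_ord_recr /= subr0.
rewrite (eq_bigr (fun k : 'I_i => l%:~R - k%:R)); last first.
  by move=> k _; rewrite /bump leq0n add1n rmorphD /= mulrSr; ring.
set P := \prod_(k < i) _; rewrite factS natrM.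
have i0 : i`!%:R != 0 :> R by rewrite pnatr_eq0 -lt0n fact_gt0.
have i1 : i.+1%:R != 0 :> R by rewrite pnatr_eq0.
rewrite rmorphD /= -natr1 in i1 *; field.
by rewrite i0.
Qed.

Lemma size_binpoly i : size (binpoly i) = i.+1.
Proof.
rewrite size_scale ?invr_eq0 ?pnatr_eq0 -?lt0n ?fact_gt0 //.
by rewrite size_prod_XsubC /index_enum -enumT size_enum_ord.
Qed.

Lemma lead_coef_binpoly i : (binpoly i)`_i = (i`!%:R)^-1.
Proof.
rewrite coefZ.
have := monic_prod_XsubC (index_enum 'I_i) xpredT (fun k => k%:R : R).
rewrite monicE /lead_coef size_prod_XsubC /index_enum -enumT size_enum_ord.
by rewrite enumT => /eqP ->; rewrite mulr1.
Qed.

(** The sign of reversing n rows: the degrees of the binomials increase from row to row while the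
    entries l_j decrease. *)
Definition eps n : R := (-1) ^+ 'C(n, 2).

Lemma epsS n : eps n.+1 = (-1) ^+ n * eps n.
Proof. by rewrite /eps binS bin1 addnC exprD. Qed.

(** Peeling with t = 1 replaces binomial(l, i+1) by its forward difference binomial(l, i) (Pascal's
    rule [binzS]), hence gives the same determinant for each interlacing signature. *)
Lemma det_binz n lam : is_sig n lam ->
  \det (\matrix_(i < n, j < n) binz i (shifted n lam j)) = eps n * GT n lam (fun=> 1).
Proof.
elim: n lam => [|n IH] lam ls; first by rewrite det_mx00 /eps expr0 mulr1.
pose psi (i : 'I_n) (l : int) := binz i.+1 l.
have := det_peel psi ls (oner_neq0 R).
rewrite (_ : \matrix_(i, j) oapp _ _ _ =
  \matrix_(i < n.+1, j < n.+1) binz i (shifted n.+1 lam j)); last first.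
  apply/matrixP => i j; rewrite !mxE; case: unliftP => [i' ->|->] //=.
  by rewrite exp1rz binz0.
move=> ->; rewrite epsS GTS -mulrA; congr (_ * _); rewrite mulr_sumr.
apply: eq_bigr => d Hd; rewrite exp1rz !mul1r -IH; last exact: is_sig_lowering.
congr (\det _); apply/matrixP => i j; rewrite !mxE /psi binzS mul1r.
by rewrite addrC addKr.
Qed.

(** A cyclic shift of n + 1 rows has sign (-1)^n. This reconciles [det_peel], whose special row is
    the first, with [detbin], whose special row is the last. *)
Lemma det_first_last n (r : nat -> 'I_n -> R) (g : nat -> R) :
  \det (\matrix_(i < n.+1, j < n.+1) oapp (r j) (g j) (unlift ord0 i))
  = (-1) ^+ n *
    \det (\matrix_(i < n.+1, j < n.+1) oapp (r j) (g j) (unlift ord_max i)).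
Proof.
rewrite (expand_det_row _ ord0) (expand_det_row _ ord_max) mulr_sumr.
apply: eq_bigr => j _; rewrite !mxE !unlift_none [RHS]mulrCA /=.
congr (_ * _); rewrite /cofactor mulrA -exprD add0n addnA !exprD -expr2 sqrr_sign.
by rewrite mul1r; congr (_ * \det _); apply/matrixP => i k; rewrite !mxE !liftK.
Qed.

(** * The one-variable formula *)

(* An arbitrary function g replaces the top-degree row of the matrix of
   binomials: g = binomial(., n) gives s_lam(1^(n+1)), and g = x^. gives
   s_lam(x, 1^n). *)
Definition detbin n lam (g : int -> R) : R :=
  \det (\matrix_(i < n.+1, j < n.+1)
     oapp (fun i' : 'I_n => binz i' (shifted n.+1 lam j))
          (g (shifted n.+1 lam j)) (unlift ord_max i)).

Lemma detbin_last n lam : is_sig n.+1 lam ->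
  detbin n lam (binz n) = eps n.+1 * GT n.+1 lam (fun=> 1).
Proof.
move=> ls; rewrite -det_binz // /detbin; congr (\det _).
apply/matrixP => i j; rewrite !mxE; case: unliftP => [i' ei|->] //=.
by rewrite ei [nat_of_ord (lift _ _)]lift_max.
Qed.

(** Peeling with t = x turns binomial(l, i) into binomial(l+1, i) - x binomial(l, i) = (1 - x)
    binomial(l, i) + binomial(l, i-1): the rows are recombined by a triangular matrix of determinant
    (1 - x)^n. *)
Lemma detbin_exp n lam x : is_sig n.+1 lam -> x != 0 ->
  detbin n lam (exprz x) =
  (x - 1) ^+ n * (eps n.+1 * GT n.+1 lam (first_var x)).
Proof.
move=> ls x0; pose psi (i : 'I_n) (l : int) := binz i l.
have := det_peel psi ls x0.
rewrite (@det_first_last n (fun j i => psi i (shifted n.+1 lam j)) (fun j => x ^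
  shifted n.+1 lam j)).
rewrite -/(detbin n lam (exprz x)) => /(congr1 ( *%R ((-1) ^+ n))).
rewrite !mulrA -!expr2 sqrr_sign !mul1r => ->.
rewrite epsS GTS -!mulrA [RHS]mulrCA.
have -> : (x - 1) ^+ n = (-1) ^+ n * (1 - x) ^+ n by rewrite -exprMn mulN1r opprB.
rewrite -!mulrA [RHS]mulrA -expr2 sqrr_sign mul1r !mulr_sumr.
apply: eq_bigr => d Hd.
pose T := \matrix_(i < n, k < n) ((1 - x) * (k == i)%:R + (k.+1 == i :> nat)%:R).
rewrite (_ : \matrix_(i, j) _ = T *m
   \matrix_(i < n, j < n) binz i (shifted n (lowering lam d) j)); last first.
  apply/matrixP => i j; rewrite !mxE /psi.
  rewrite (eq_bigr (fun k : 'I_n =>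
     (k == i)%:R * ((1 - x) * binz i (shifted n (lowering lam d) j))
     + (k.+1 == i :> nat)%:R * binz i.-1 (shifted n (lowering lam d) j))); last first.
    move=> k _; rewrite !mxE mulrDl; congr (_ + _).
      by case: eqP => [->|_]; rewrite ?mul1r ?mulr1 // mulr0 !mul0r.
    by case: eqP => [<-|_]; rewrite ?mul1r // !mul0r.
  rewrite big_split /= (bigD1 i) //= eqxx mul1r big1 ?addr0; last first.
    by move=> k /negPf ->; rewrite mul0r.
  case: i => [[|i] Hi] /=.
    by rewrite !binz0 big1 ?addr0 ?mulr1 // => k _; rewrite mul0r.
  rewrite (bigD1 (Ordinal (ltnW Hi))) //= eqxx mul1r big1 ?addr0; last first.
    move=> k; rewrite -val_eqE /= eqSS => /negPf ->; by rewrite mul0r.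
  by rewrite binzS; ring.
rewrite det_mulmx det_trig; last first.
  apply/is_trig_mxP => i j ij; rewrite mxE -val_eqE /=.
  by rewrite !gtn_eqF ?mulr0 ?addr0 // (ltn_trans ij).
rewrite det_binz; last exact: is_sig_lowering.
rewrite (eq_bigr (fun=> 1 - x)); last first.
  by move=> i _; rewrite mxE eqxx mulr1 gtn_eqF ?addr0.
by rewrite prodr_const card_ord; ring.
Qed.

(** The cofactors along the last row do not involve [g]. This linearity lets [g] be expanded in
    powers inside the determinant. *)
Lemma detbin_expand n lam : exists c : 'I_n.+1 -> R, forall g,
  detbin n lam g = \sum_(j < n.+1) g (shifted n.+1 lam j) * c j.
Proof.
exists (cofactor (\matrix_(i < n.+1, j < n.+1)
     oapp (fun i' : 'I_n => binz i' (shifted n.+1 lam j)) 0 (unlift ord_max i)) ord_max).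
move=> g; rewrite /detbin (expand_det_row _ ord_max).
apply: eq_bigr => j _; rewrite mxE unlift_none /=; congr (_ * _).
by rewrite /cofactor; congr (_ * \det _); apply/matrixP => i k; rewrite !mxE !liftK.
Qed.

End Binomial.

(** * Complete homogeneous sums and divided differences *)

Section CompleteSymmetric.
Variable R : fieldType.

Fixpoint hsym (s : seq R) (m : nat) : R :=
  if s is a :: s' then \sum_(i < m.+1) a ^+ i * hsym s' (m - i) else (m == 0)%:R.

#[global] Arguments hsym : simpl never.

Definition psum (s : seq R) (j : nat) : R := \sum_(a <- s) a ^+ j.

Lemma hsym_cons a s m :
  hsym (a :: s) m = \sum_(i < m.+1) a ^+ i * hsym s (m - i).
Proof. by []. Qed.

Lemma hsym0 s : hsym s 0 = 1.
Proof. by elim: s => [|a s IH] //; rewrite hsym_cons big_ord1 mul1r IH. Qed.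

Lemma hsymS a s m : hsym (a :: s) m.+1 = hsym s m.+1 + a * hsym (a :: s) m.
Proof.
rewrite !hsym_cons big_ord_recl mul1r subn0; congr (_ + _).
by rewrite mulr_sumr; apply: eq_bigr => i _; rewrite exprS -mulrA.
Qed.

Lemma sum_hsym_cons a s (c : nat -> R) m :
  \sum_(j < m.+1) c j * hsym (a :: s) (m - j)
  = \sum_(j < m.+1) c j * hsym s (m - j)
    + a * \sum_(j < m) c j * hsym (a :: s) (m - j.+1).
Proof.
rewrite !big_ord_recr /= !subnn !hsym0 [RHS]addrAC mulr_sumr -big_split /=.
congr (_ + _); apply: eq_bigr => j _.
by rewrite -(subnSK (ltn_ord j)) hsymS mulrDr mulrCA.
Qed.

(** A new point a adds a^j to p_j; convolved with h(s), these powers sum to a h_m(a :: s), and the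
    rest is the identity for s and, one degree lower, for a :: s. *)
Lemma newton s m : m%:R * hsym s m = \sum_(j < m) psum s j.+1 * hsym s (m - j.+1).
Proof.
elim: s m => [|a s IHs] m.
  case: m => [|m]; first by rewrite mul0r big_ord0.
  by rewrite mulr0 big1 // => j _; rewrite /psum big_nil mul0r.
elim: m => [|m IHm]; first by rewrite mul0r big_ord0.
under [RHS]eq_bigr => j _ do rewrite subSS.
rewrite (sum_hsym_cons a s (fun j => psum (a :: s) j.+1)) -IHm hsymS mulrDr IHs.
have -> : \sum_(j < m.+1) psum (a :: s) j.+1 * hsym s (m - j)
  = \sum_(j < m.+1) psum s j.+1 * hsym s (m.+1 - j.+1) + a * hsym (a :: s) m.
  rewrite hsym_cons mulr_sumr -big_split; apply: eq_bigr => j _ /=.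
  by rewrite /psum big_cons subSS exprS; ring.
by rewrite -natr1; ring.
Qed.

(* The divided difference of p at the points of s, as the leading coefficient
   of the interpolating polynomial. *)
Definition topcoef (s : seq R) (p : {poly R}) : R :=
  (p %% \prod_(a <- s) ('X - a%:P))`_(size s).-1.

Lemma size_prod_nodes (s : seq R) : size (\prod_(a <- s) ('X - a%:P)) = (size s).+1.
Proof. exact: size_prod_XsubC. Qed.

Lemma topcoef_small s (p : {poly R}) : (size p <= size s)%N ->
  topcoef s p = p`_(size s).-1.
Proof. by move=> sp; rewrite /topcoef modp_small // size_prod_nodes ltnS. Qed.

Lemma topcoefD s p q : topcoef s (p + q) = topcoef s p + topcoef s q.
Proof. by rewrite /topcoef modpD coefD. Qed.

Lemma topcoefZ s c p : topcoef s (c *: p) = c * topcoef s p.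
Proof. by rewrite /topcoef modpZl coefZ. Qed.

(** With P the nodal polynomial of [s], the remainder of p (X - a) modulo (X - a) P is (X - a) (p
    mod P): the factor X - a cancels the node a. *)
Lemma topcoefMXsubC a s p : s != [::] ->
  topcoef (a :: s) (p * ('X - a%:P)) = topcoef s p.
Proof.
move=> s0; rewrite /topcoef big_cons; set P := \prod_(b <- s) _.
have P0 : P != 0 by rewrite -size_poly_gt0 size_prod_nodes.
have sr : (size (p %% P)%R < (size s).+1)%N by rewrite -(size_prod_nodes s) ltn_modp.
rewrite {1}(divp_eq p P) mulrDl -mulrA [P * _]mulrC modpD modp_mull add0r.
have [->|r0] := eqVneq (p %% P) 0; first by rewrite mul0r mod0p !coef0.
rewrite modp_small; last first.
  rewrite [('X - a%:P) * P]mulrC !size_Mmonic ?monicXsubC // size_XsubC.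
  by rewrite size_prod_nodes !addn2 /= ltnS.
have sz : (size s).-1.+1 = size s by case: (s) s0.
rewrite /= -{1}sz mulrBr coefB coefMX /= coefMC sz.
by rewrite [X in _ - X * _]nth_default ?mul0r ?subr0.
Qed.

(** Writing X^(e+1) = X^e (X - a) + a X^e gives the divided differences of powers the recursion
    [hsymS]. *)
Lemma topcoef_Xn s e : s != [::] ->
  topcoef s 'X^e = if (e < (size s).-1)%N then 0 else hsym s (e - (size s).-1).
Proof.
elim: s e => [//|a s IHs] e _; case: s IHs => [_|b s /(_ _ isT) IHs].
  rewrite /= subn0 hsym_cons big_ord_recr big1 /= ?add0r; last first.
    by move=> i _; rewrite /hsym subn_eq0 leqNgt ltn_ord mulr0.
  by rewrite subnn hsym0 mulr1 /topcoef big_seq1 modp_XsubC coefC hornerXn.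
set s' := b :: s in IHs *; have -> : (size (a :: s')).-1 = size s' by [].
elim: e => [|e IHe]; first by rewrite topcoef_small ?size_polyXn // coefXn.
have -> : topcoef (a :: s') 'X^(e.+1) = topcoef s' 'X^e + a * topcoef (a :: s') 'X^e.
  rewrite -(@topcoefMXsubC a s' 'X^e isT) -topcoefZ -topcoefD.
  by congr topcoef; rewrite mulrBr -exprSr -mul_polyC mulrC addrNK.
rewrite IHs IHe {IHs IHe}.
have [n ->] : exists n, size s' = n.+1 by exists (size s).
rewrite -pred_Sn !ltnS; case: (ltngtP e n) => [lt|gt|->].
- by rewrite mulr0 addr0.
- by rewrite subSS -(subnSK gt) [RHS]hsymS.
- by rewrite !subnn !hsym0 mulr0 addr0.
Qed.

End CompleteSymmetric.

(** * Polynomials in the last row of the determinant *)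

Section DividedDifference.
Variable R : numFieldType.

Definition nodes n (lam : nat -> int) (c : R) : seq R :=
  [seq (shifted n lam j)%:~R - c | j <- iota 0 n].

(** The free shift [c] is what later allows the nodes to be centred. *)
Definition detpoly n lam (c : R) (p : {poly R}) : R :=
  detbin n lam (fun l => p.[l%:~R - c]).

Lemma size_nodes n lam c : size (nodes n lam c) = n.
Proof. by rewrite size_map size_iota. Qed.

Lemma detpolyD n lam c p q : detpoly n lam c (p + q) =
  detpoly n lam c p + detpoly n lam c q.
Proof.
rewrite /detpoly; have [C HC] := @detbin_expand R n lam; rewrite !HC -big_split.
by apply: eq_bigr => j _; rewrite hornerD mulrDl.
Qed.

Lemma detpolyZ n lam c a p : detpoly n lam c (a *: p) = a * detpoly n lam c p.
Proof.
rewrite /detpoly; have [C HC] := @detbin_expand R n lam; rewrite !HC mulr_sumr.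
by apply: eq_bigr => j _; rewrite hornerZ mulrA.
Qed.

(** All n + 1 rows are then values of polynomials of degree below n, hence linearly dependent:
    factored through the monomials, the coefficient matrix has a zero last column. *)
Lemma detpoly_low n lam c (p : {poly R}) : (size p <= n)%N -> detpoly n lam c p = 0.
Proof.
move=> sp; pose q (i : 'I_n.+1) : {poly R} :=
  oapp (fun i' : 'I_n => binpoly R i' \Po ('X + c%:P)) p (unlift ord_max i).
have sq i : (size (q i) <= n)%N.
  rewrite /q; case: unliftP => [i' _|_] //=.
  by rewrite size_comp_poly2 ?size_XaddC // size_binpoly.
rewrite /detpoly /detbin (_ : \matrix_(i, j) _ =
  (\matrix_(i < n.+1, k < n.+1) (q i)`_k) *m
  (\matrix_(k < n.+1, j < n.+1) ((shifted n.+1 lam j)%:~R - c) ^+ k)); last first.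
  apply/matrixP => i j; rewrite !mxE.
  have -> : oapp (fun i' : 'I_n => binz R i' (shifted n.+1 lam j))
      p.[(shifted n.+1 lam j)%:~R - c] (unlift ord_max i)
      = (q i).[(shifted n.+1 lam j)%:~R - c].
    rewrite /q; case: unliftP => [i' _|_] //=.
    by rewrite horner_comp /binz hornerD hornerX hornerC subrK.
  rewrite (horner_coef_wide _ (leqW (sq i))).
  by apply: eq_bigr => k _; rewrite !mxE.
rewrite det_mulmx (expand_det_col _ ord_max) big1 ?mul0r // => i _.
by rewrite mxE nth_default ?mul0r.
Qed.

(** Reducing [p] modulo the nodal polynomial changes no value at the nodes; of the remainder,
    [detpoly_low] leaves only the coefficient of degree n, which is the divided difference. *)
Lemma detpoly_topcoef n lam c p :
  detpoly n lam c p = detpoly n lam c 'X^n * topcoef (nodes n.+1 lam c) p.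
Proof.
set s := nodes n.+1 lam c; pose P := \prod_(a <- s) ('X - a%:P).
have Ps : size P = n.+2 by rewrite size_prod_nodes size_nodes.
have P0 : P != 0 by rewrite -size_poly_gt0 Ps.
set r := p %% P; have sr : (size r <= n.+1)%N by rewrite -ltnS -Ps ltn_modp.
have -> : detpoly n lam c p = detpoly n lam c r.
  rewrite /detpoly; have [C HC] := @detbin_expand R n lam; rewrite !HC.
  apply: eq_bigr => j _; congr (_ * _); rewrite {1}(divp_eq p P) hornerD hornerM.
  suff /rootP -> : root P ((shifted n.+1 lam j)%:~R - c) by rewrite mulr0 add0r.
  rewrite root_prod_XsubC; apply/mapP; exists (val j) => //.
  by rewrite mem_iota add0n /=.
have -> : topcoef s p = r`_n by rewrite /topcoef size_nodes.
have -> : r = (r - r`_n *: 'X^n) + r`_n *: 'X^n by rewrite subrK.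
rewrite detpolyD detpolyZ detpoly_low ?add0r; last first.
  apply/leq_sizeP => k nk; rewrite coefB coefZ coefXn.
  case: ltngtP nk => // [nk _|<- _]; last by rewrite mulr1 subrr.
  by rewrite mulr0 subr0 nth_default // (leq_trans sr).
rewrite coefD coefB coefZ coefXn eqxx mulr1 subrr add0r mulrC //.
Qed.

Lemma detpoly_Xn n lam c e :
  detpoly n lam c 'X^e = detpoly n lam c 'X^n *
    (if (e < n)%N then 0 else hsym (nodes n.+1 lam c) (e - n)).
Proof.
rewrite detpoly_topcoef topcoef_Xn ?size_nodes //.
Qed.

Lemma detbin_binz_detpoly n lam c :
  detbin n lam (binz R n) = detpoly n lam c 'X^n / n`!%:R.
Proof.
have -> : detbin n lam (binz R n) = detpoly n lam c (binpoly R n \Po ('X + c%:P)).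
  rewrite /detpoly; have [C HC] := @detbin_expand R n lam; rewrite !HC.
  apply: eq_bigr => j _; congr (_ * _).
  by rewrite horner_comp /binz hornerD hornerX hornerC subrK.
have sq : size (binpoly R n \Po ('X + c%:P)) = n.+1.
  by rewrite size_comp_poly2 ?size_XaddC // size_binpoly.
rewrite detpoly_topcoef; congr (_ * _).
rewrite topcoef_small ?size_nodes ?sq //=.
have := lead_coef_comp (binpoly R n) (_ : 1 < size ('X + c%:P)%R)%N.
rewrite size_XaddC lead_coefXaddC expr1n mulr1 /lead_coef sq size_binpoly => ->//.
exact: lead_coef_binpoly.
Qed.

End DividedDifference.

(** * The one-variable quotient as a power series *)

Section OneVariable.
Variable R : realType.

Lemma cvg_fin_sum (T I : Type) (F : set_system T) (FF : Filter F) (r : seq I)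
    (f : I -> T -> R) (a : I -> R) :
  (forall i, f i x @[x --> F] --> a i) ->
  \sum_(i <- r) f i x @[x --> F] --> \sum_(i <- r) a i.
Proof. by move=> H; apply: cvg_big => // x; exact: add_continuous. Qed.

Lemma expR_exprz (x : R) (l : int) : expR x ^ l = expR (x * l%:~R).
Proof.
case: l => n; first by rewrite -exprnP expRM_natr.
by rewrite NegzE -exprnN -expRM_natr -expRN rmorphN /= mulrN.
Qed.

(* The expectation of (y * sum_i t_i s_i)^m / m! for t uniform on the simplex
   (Hermite-Genocchi). *)
Definition simplex_term (s : seq R) (n : nat) (y : R) (m : nat) : R :=
  y ^+ m * hsym s m * (n`!%:R / (m + n)`!%:R).

(** The factor e^(y c) comes from the recentring. In the exponential series of the last row the
    powers e < n contribute nothing ([detpoly_Xn]), and e = n + m contributes h_m of the nodes. *)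
Lemma detbin_expR n lam (c y v : R) :
  series (simplex_term (nodes n.+1 lam c) n y) @ \oo --> v ->
  detbin n lam (exprz (expR y)) =
  expR (y * c) * (detpoly n lam c 'X^n * (y ^+ n / n`!%:R) * v).
Proof.
move=> cv; have [C HC] := @detbin_expand R n lam.
pose a (j : 'I_n.+1) : R := (shifted n.+1 lam j)%:~R - c.
pose W := \sum_(j < n.+1) expR (y * a j) * C j.
have -> : detbin n lam (exprz (expR y)) = expR (y * c) * W.
  rewrite HC mulr_sumr; apply: eq_bigr => j _.
  by rewrite expR_exprz mulrA -expRD -mulrDr /a addrC subrK.
congr (_ * _).
have c1 : \sum_(j < n.+1) series (exp_coeff (y * a j)) N * C j @[N --> \oo] --> W.
  by apply: cvg_fin_sum => j; apply: cvgMr_tmp; exact: is_cvg_series_exp_coeff.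
have E N : \sum_(j < n.+1) series (exp_coeff (y * a j)) N * C j =
    \sum_(0 <= e < N) y ^+ e / e`!%:R * detpoly n lam c 'X^e.
  under eq_bigr do rewrite /series /= mulr_suml.
  rewrite exchange_big; apply: eq_bigr => e _.
  rewrite /detpoly HC mulr_sumr; apply: eq_bigr => j _.
  by rewrite hornerXn -/(a j) /exp_coeff /= exprMn; ring.
have E2 M : \sum_(0 <= e < M + n) y ^+ e / e`!%:R * detpoly n lam c 'X^e =
   detpoly n lam c 'X^n * (y ^+ n / n`!%:R) * series (simplex_term (nodes n.+1 lam c)
     n y) M.
  rewrite addnC (big_cat_nat (n := n)) ?leq_addr //= big_nat_cond big1 ?add0r; last first.
    by move=> e; rewrite andbT => /andP[_ en]; rewrite detpoly_Xn en !mulr0.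
  rewrite -{1}[n]add0n big_addn addKn /series /= mulr_sumr.
  apply: eq_bigr => m _; rewrite detpoly_Xn ltnNge leq_addl /= addnK /simplex_term.
  rewrite exprD; have f0 : n`!%:R != 0 :> R by rewrite pnatr_eq0 -lt0n fact_gt0.
  have f1 : (m + n)`!%:R != 0 :> R by rewrite pnatr_eq0 -lt0n fact_gt0.
  by field; rewrite f0 f1.
have c2 : (fun M => \sum_(j < n.+1) series (exp_coeff (y * a j)) (M
  + n)%N * C j) @ \oo --> W.
  by rewrite (cvg_shiftn n (fun N => \sum_(j < n.+1) series (exp_coeff (y * a j)) N *
    C j)).
have c3 : (fun M => \sum_(j < n.+1) series (exp_coeff (y * a j)) (M
  + n)%N * C j) @ \oo -->
     detpoly n lam c 'X^n * (y ^+ n / n`!%:R) * v.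
  by under eq_fun do rewrite E E2; apply: cvgMl_tmp.
by apply: cvg_unique c2 c3.
Qed.

(** Only the zero signature interlaces zero, so every variable carries the exponent 0. *)
Lemma GT_zero n lam (u : nat -> R) : (forall i, (i < n)%N -> lam i = 0) ->
  GT n lam u = GT n lam (fun=> 1).
Proof.
elim: n lam u => [//|n IH] lam u l0; rewrite !GTS.
have ls : is_sig n.+1 lam by move=> j jn; rewrite !l0 // ltnW.
apply: eq_bigr => d Hd.
have m0 i : (i < n)%N -> lowering lam d i = 0.
  by move=> lin; have := lowering_bounds ls Hd lin; rewrite !l0 ?ltnS // 1?ltnW //; lia.
rewrite IH // /weight !big1 ?subrr ?expr0z //.
- by move=> i _; rewrite m0.
- by move=> i _; rewrite l0.
Qed.

Lemma schur_one_var n lam (c c0 y v v0 : R) : is_sig n.+1 lam ->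
  series (simplex_term (nodes n.+1 lam c) n y) @ \oo --> v ->
  series (simplex_term (nodes n.+1 (fun=> 0) c0) n y) @ \oo --> v0 ->
  GT n.+1 lam (first_var (expR y)) / GT n.+1 lam (fun=> 1) =
    expR (y * (c - c0)) * (v / v0).
Proof.
have G1 l : GT n.+1 l (fun=> 1) != 0 :> R by rewrite gt_eqF // GT_gt0.
(* The case y = 0 is treated apart because [main] divides by e^y - 1; both series then reduce to
   their term m = 0, which is 1. *)
move=> ls cv cv0; have [y0|y0] := eqVneq y 0.
  have one (s : seq R) (w : R) : series (simplex_term s n y) @ \oo --> w -> w = 1.
    move=> cw; apply: (cvg_unique _ cw) => //; apply: cvg_near_cst.
    exists 1%N => // -[//|N] _ /=; rewrite /series /= big_nat_recl // big1 ?addr0.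
      by rewrite /simplex_term y0 expr0 hsym0 add0n divff ?mulr1 // pnatr_eq0 -lt0n
        fact_gt0.
    by move=> m _; rewrite /simplex_term y0 expr0n /= !mul0r.
  rewrite (one _ _ cv) (one _ _ cv0) y0 mul0r expR0 divr1 mulr1.
  by rewrite (_ : first_var 1 = fun=> 1) ?divff //; apply/funext => -[].
have f0 : n`!%:R != 0 :> R by rewrite pnatr_eq0 -lt0n fact_gt0.
have x1 : expR y - 1 != 0 by rewrite subr_eq0 -[X in _ != X](expR0 R) (inj_eq
  (@expR_inj R)).
have e1 : eps R n.+1 != 0 by rewrite signr_eq0.
have main l b (w : R) : is_sig n.+1 l -> series (simplex_term (nodes n.+1 l b) n y) @
  \oo --> w ->
    GT n.+1 l (first_var (expR y)) / GT n.+1 l (fun=> 1)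
    = expR (y * b) * (y ^+ n / (expR y - 1) ^+ n) * w.
  move=> dl cw; have H1 := detbin_exp dl (lt0r_neq0 (expR_gt0 y)).
  have H2 := detbin_last R dl; rewrite (detbin_binz_detpoly n l b) in H2.
  have D0 : detpoly n l b 'X^n = n`!%:R * (eps R n.+1 * GT n.+1 l (fun=> 1)).
    by rewrite -H2 mulrC divfK.
  rewrite (detbin_expR cw) D0 in H1.
  have -> : GT n.+1 l (first_var (expR y)) =
      ((expR y - 1) ^+ n * (eps R n.+1 * GT n.+1 l (first_var (expR y))))
      / ((expR y - 1) ^+ n * eps R n.+1).
    by field; rewrite e1 expf_neq0.
  rewrite -H1; field.
  by rewrite f0 e1 G1 expf_neq0.
have z1 : is_sig n.+1 (fun=> 0) by [].
have Z := main _ _ _ z1 cv0; rewrite GT_zero // divff // in Z.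
have v00 : v0 != 0 by apply/eqP => v00; move: Z; rewrite v00 mulr0 => /eqP;
  rewrite oner_eq0.
rewrite (main _ _ _ ls cv) mulrBr expRD expRN.
have e0 := lt0r_neq0 (expR_gt0 (y * c0)).
set Q := _ / _ in Z *; have -> : Q = (expR (y * c0) * v0)^-1.
  by apply: (mulIf (mulf_neq0 e0 v00)); rewrite mulVf ?mulf_neq0 // [RHS]Z; ring.
by field; rewrite v00 e0.
Qed.

End OneVariable.

(** * Asymptotics of Newton's recursion *)

Section GaussianSeries.
Variable R : realType.

(* The Taylor coefficients of exp (w z^2 / 2). *)
Fixpoint gauss_coef (w : R) (m : nat) : R :=
  match m with
  | 0 => 1
  | 1 => 0
  | m'.+2 => w / m%:R * gauss_coef w m'
  end.

Lemma gauss_coefSS w m : gauss_coef w m.+2 = w / m.+2%:R * gauss_coef w m.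
Proof. by []. Qed.

Lemma gauss_coef_even w k : gauss_coef w k.*2 = exp_coeff (w / 2) k.
Proof.
elim: k => [|k IH]; first by rewrite /exp_coeff /= expr0 invr1 mulr1.
have k0 : k`!%:R != 0 :> R by rewrite pnatr_eq0 -lt0n fact_gt0.
rewrite doubleS gauss_coefSS IH /exp_coeff /= factS exprS natrM -doubleS -muln2 natrM.
have k1 : k.+1%:R != 0 :> R by rewrite pnatr_eq0.
by field; rewrite addrC natr1 k0 k1.
Qed.

Lemma gauss_coef_odd w k : gauss_coef w k.*2.+1 = 0.
Proof. by elim: k => [|k IH] //; rewrite doubleS gauss_coefSS IH mulr0. Qed.

Lemma gauss_series w : series (gauss_coef w) @ \oo --> expR (w / 2).
Proof.
(* Odd coefficients vanish, and [uphalf n] counts the even indices below n. *)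
have E n : series (gauss_coef w) n = series (exp_coeff (w / 2)) (uphalf n).
  elim: n => [|n IH]; first by rewrite /series /= !big_geq.
  have -> : series (gauss_coef w) n.+1 = series (gauss_coef w) n + gauss_coef w n.
    by rewrite /series /= big_nat_recr.
  rewrite {}IH.
  have -> : uphalf n.+1 = n./2.+1 by [].
  have := odd_double_half n; rewrite uphalf_half.
  move: (odd n) n./2 => [] k <-; first by rewrite !add1n gauss_coef_odd addr0.
  by rewrite !add0n gauss_coef_even [RHS]/series /= big_nat_recr.
have -> : series (gauss_coef w) = series (exp_coeff (w / 2)) \o uphalf.
  by apply/funext => n; rewrite E.
apply: cvg_comp; last exact: is_cvg_series_exp_coeff.
apply/cvgnyPge => N; exists N.*2 => // n /= Nn.
by rewrite -(doubleK N) uphalf_half (leq_trans (half_leq Nn)) ?leq_addl.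
Qed.

Lemma geometric_half_sum (m n : nat) : \sum_(m <= i < n) (2^-1 : R) ^+ i <= 2 * 2^-1 ^+ m.
Proof.
have [mn|nm] := leqP m n; last first.
  by rewrite big_geq ?(ltnW nm) // mulr_ge0 // exprn_ge0 // invr_ge0.
have -> : \sum_(m <= i < n) (2^-1 : R) ^+ i = 2 * 2^-1 ^+ m - 2 * 2^-1 ^+ n.
  rewrite (eq_big_nat _ _ (F2 := fun i => (- 2 * 2^-1 ^+ i.+1) - (- 2 * (2^-1 : R) ^+
    i))).
    by rewrite telescope_sumr //; ring.
  by move=> i _; rewrite exprS; field.
by rewrite gerBl mulr_ge0 // exprn_ge0 // invr_ge0.
Qed.

Section Filter.
Variables (T : Type) (F : set_system T).
Context {FF : Filter F}.

Lemma cvg_pow (f : T -> R) (a : R) n : f @ F --> a -> f t ^+ n @[t --> F] --> a ^+ n.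
Proof.
move=> fa; elim: n => [|n IH].
  by under eq_cvg do rewrite expr0; rewrite expr0; exact: cvg_cst.
by under eq_cvg do rewrite exprS; rewrite exprS; apply: cvgM.
Qed.

(** The geometric majorant makes the tails small uniformly in [t], and a fixed number of terms
    converges termwise. *)
Lemma tannery (A : T -> nat -> R) (be : nat -> R) (K l : R) (s : T -> R) :
  (forall m, A t m @[t --> F] --> be m) ->
  (\forall t \near F, forall m, `|A t m| <= K * 2^-1 ^+ m) ->
  (\forall t \near F, series (A t) @ \oo --> s t) ->
  series be @ \oo --> l -> s @ F --> l.
Proof.
move=> cA dA sA cb.
(* [F] is not assumed proper, so [0 <= K] can only be asserted near [F]. *)
have K0 : \forall t \near F, 0 <= K.
  by apply: filterS dA => t /(_ 0%N); rewrite expr0 mulr1; apply: le_trans.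
have tail : \forall t \near F, forall M, `|s t - series (A t) M| <= K * (2 * 2^-1 ^+ M).
  apply: filterS3 K0 dA sA => t K0 dA /cvgrPdist_lt sA M.
  apply/ler_addgt0Pl => e e0; have [N _ HN] := sA e e0.
  have {}HN := HN (maxn M N) (leq_maxr M N).
  rewrite (le_trans (ler_distD (series (A t) (maxn M N)) _ _)) // lerD //;
    first exact: ltW.
  rewrite sub_series_geq ?leq_maxl // (le_trans (ler_norm_sum _ _ _)) //.
  rewrite (le_trans (ler_sum _ (fun m _ => dA m))) // -mulr_sumr.
  by rewrite ler_wpM2l // geometric_half_sum.
apply/cvgrPdist_le => e e0; have e3 : 0 < e / 3 by rewrite divr_gt0.
have [M1 _ H1] : \forall M \near \oo, K * (2 * 2^-1 ^+ M) <= e / 3.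
  have : (fun M => K * (2 * 2^-1 ^+ M)) @ \oo --> (K * (2 * 0) : R).
    apply: cvgMl_tmp; apply: cvgMl_tmp; apply: cvg_expr.
    by rewrite ger0_norm ?invr_ge0 // invf_lt1 // ltr1n.
  rewrite !mulr0 => /cvgrPdist_le /(_ _ e3).
  apply: filterS => M; rewrite sub0r normrN; exact/le_trans/ler_norm.
have [M2 _ H2] : \forall M \near \oo, `|l - series be M| <= e / 3.
  by have /cvgrPdist_le := cb; apply.
pose M := maxn M1 M2.
have h1 : K * (2 * 2^-1 ^+ M) <= e / 3 by apply: H1; exact: leq_maxl.
have h2 : `|l - series be M| <= e / 3 by apply: H2; exact: leq_maxr.
have h3 : \forall t \near F, `|series be M - series (A t) M| <= e / 3.
  have : series (A t) M @[t --> F] --> series be M by apply: cvg_fin_sum.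
  by move/cvgrPdist_le; apply.
apply: filterS2 tail h3 => t /(_ M) tl h3.
rewrite distrC in tl.
have -> : l - s t = (l - series be M) + (series be M - series (A t) M)
  + (series (A t) M - s t) by ring.
rewrite (le_trans (ler_normD _ _)) //.
have -> : e = (e / 3 + e / 3) + e / 3 by field.
rewrite lerD // ?(le_trans tl) //.
by rewrite (le_trans (ler_normD _ _)) // lerD.
Qed.

Section Newton.
(* B and b stand for rescaled complete homogeneous and power sums of centred
   points: b_1 = 0, b_2 converges and b_3, b_4, ... vanish in the limit. *)
Variables (B b : T -> nat -> R) (w G : R) (kap : T -> R).
Hypotheses (B0 : forall t, B t 0 = 1)
  (Brec : forall t m, m.+1%:R * B t m.+1 = \sum_(j < m.+1) b t j.+1 * B t (m - j)%N)
  (b1 : forall t, b t 1 = 0)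
  (bw : b t 2 @[t --> F] --> w)
  (bG : \forall t \near F, forall j, `|b t j.+2| <= G * kap t ^+ j)
  (kap0 : forall t, 0 <= kap t) (kapl : kap @ F --> (0 : R)).

(** In the limit the recursion keeps only b_2 and becomes m B_m = w B_(m-2), the recursion of
    [gauss_coef]. *)
Lemma newton_cvg m : B t m @[t --> F] --> gauss_coef w m.
Proof.
pose bl (j : nat) : R := if j == 2%N then w else 0.
have cb j : b t j.+1 @[t --> F] --> bl j.+1.
  case: j => [|[|j]]; rewrite /bl /=.
  - by under eq_cvg do rewrite b1; exact: cvg_cst.
  - exact: bw.
  - apply: norm_cvg0.
    apply: (@squeeze_cvgr _ _ _ _ (fun=> 0) (fun t => G * kap t ^+ j.+1)).
    + by apply: filterS bG => t H; rewrite normr_ge0 H.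
    + exact: cvg_cst.
    + have -> : (0 : R) = G * 0 ^+ j.+1 by rewrite expr0n mulr0.
      by apply: cvgMl_tmp; exact: cvg_pow.
elim/ltn_ind: m => -[|m] IH.
  by under eq_cvg do rewrite B0; exact: cvg_cst.
have -> : gauss_coef w m.+1 = m.+1%:R^-1 * \sum_(j < m.+1) bl j.+1 * gauss_coef w (m -
  j)%N.
  case: m {IH} => [|m]; first by rewrite big_ord1 /bl /= mul0r mulr0.
  rewrite !big_ord_recl /bl /= mul0r add0r big1 ?addr0 => [|j _]; last by rewrite mul0r.
  by rewrite subSS subn0; ring.
have -> : (fun t => B t m.+1) = (fun t => m.+1%:R^-1 * \sum_(j < m.+1) b t j.+1 * B t
  (m - j)%N).
  by apply/funext => t; rewrite -Brec mulKf // pnatr_eq0.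
apply: cvgMl_tmp; apply: cvg_fin_sum => j; apply: cvgM; first exact: cb.
by apply: IH; rewrite ltnS leq_subr.
Qed.

(** Induction on m for |B_m| <= E_m / 2^m with E_m = M^min(m, M). The recursion yields (m+1)
    |B_(m+1)| <= M E_m / 2^(m+1): as long as m + 1 <= M the factor M is absorbed by the growth of E,
    afterwards by the division by m + 1. *)
Lemma newton_bound : exists K : R, \forall t \near F, forall m, `|B t m| <= K * 2^-1 ^+ m.
Proof.
(* Once kap <= 1/4, term i of the recursion is at most 4 G E_m 2^-(m+1) 2^-i; summing over i gives
   the 8. *)
pose M := (Num.truncn (8 * G)).+1.
have MG : 8 * G <= M%:R by exact/ltW/truncnS_gt.
have M1 : 1 <= M%:R :> R by rewrite ler1n.
pose E m : R := M%:R ^+ minn m M.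
have E0 m : 0 <= E m by rewrite exprn_ge0.
have Ele m p : (m <= p)%N -> E m <= E p.
  by move=> mp; rewrite /E ler_weXn2l // leq_min geq_minr (leq_trans (geq_minl _ _)).
exists (M%:R ^+ M).
have kap4 : \forall t \near F, kap t <= 4^-1.
  have /cvgrPdist_le /(_ 4^-1) := kapl; rewrite invr_gt0 ltr0n => /(_ isT).
  by apply: filterS => t; rewrite sub0r normrN ger0_norm.
apply: filterS2 kap4 bG => t k4 bG'.
have G0 : 0 <= G by have := bG' 0%N; rewrite expr0 mulr1; apply: le_trans.
suff H m : `|B t m| <= E m * 2^-1 ^+ m.
  move=> m; apply: le_trans (H m) _; rewrite ler_wpM2r ?exprn_ge0 ?invr_ge0 //.
  by rewrite /E ler_weXn2l // geq_minr.
elim/ltn_ind: m => -[_|m IH]; first by rewrite B0 normr1 /E min0n !expr0 mulr1.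
have step : m.+1%:R * `|B t m.+1| <= M%:R * E m * 2^-1 ^+ m.+1.
  rewrite -[m.+1%:R]ger0_norm // -normrM Brec big_ord_recl b1 mul0r add0r.
  rewrite (le_trans (ler_norm_sum _ _ _)) //.
  have term (i : 'I_m) : `|b t (lift ord0 i).+1 * B t (m - lift ord0 i)%N|
      <= (4 * G * E m * 2^-1 ^+ m.+1) * 2^-1 ^+ i.
    have -> : lift ord0 i = i.+1 :> nat by [].
    have h1 : `|b t i.+2| <= G * (4^-1) ^+ i.
      by rewrite (le_trans (bG' i)) // ler_wpM2l // lerXn2r // ?nnegrE ?kap0 ?invr_ge0.
    have h2 : `|B t (m - i.+1)%N| <= E m * 2^-1 ^+ (m - i.+1).
      rewrite (le_trans (IH _ _)) ?ltnS ?leq_subr //.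
      by rewrite ler_wpM2r ?exprn_ge0 ?invr_ge0 // Ele // leq_subr.
    rewrite normrM (le_trans (ler_pM _ _ h1 h2)) //.
    have -> : m.+1 = ((m - i.+1) + i.+2)%N by rewrite addnS subnK.
    rewrite exprD !exprS (_ : 4^-1 = 2^-1 * 2^-1 :> R); last by field.
    by rewrite exprMn le_eqVlt; apply/orP; left; apply/eqP; field.
  rewrite (le_trans (ler_sum _ (fun i _ => term i))) // -mulr_sumr.
  have := geometric_half_sum 0 m; rewrite big_mkord expr0 mulr1 => hs.
  rewrite (le_trans (ler_wpM2l _ hs)) ?mulr_ge0 ?exprn_ge0 ?invr_ge0 //.
  have -> : 4 * G * E m * 2^-1 ^+ m.+1 * 2 = 8 * G * E m * 2^-1 ^+ m.+1 by ring.
  by rewrite !ler_wpM2r ?exprn_ge0 ?invr_ge0.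
have m0 : 0 < m.+1%:R :> R by rewrite ltr0n.
rewrite -(ler_pM2l m0) (le_trans step) // mulrA ler_wpM2r ?exprn_ge0 ?invr_ge0 //.
have [mM|Mm] := leqP m.+1 M.
  have -> : E m.+1 = M%:R * E m by rewrite /E (minn_idPl mM) (minn_idPl (ltnW mM)) exprS.
  by rewrite ler_peMl ?mulr_ge0 // ler1n.
by rewrite ler_pM // ?Ele // ler_nat ltnW.
Qed.

End Newton.
End Filter.
End GaussianSeries.

(** * Limit of the series for centred nodes *)

Section SimplexLimit.
Variables (R : realType) (T : Type) (F : set_system T).
Context {FF : Filter F}.

Lemma cvg_series_geometric_bound (a : nat -> R) K :
  (forall m, `|a m| <= K * 2^-1 ^+ m) -> cvgn (series a).
Proof.
move=> aK; apply: normed_cvg.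
apply: (@series_le_cvg _ _ (geometric K 2^-1)) => [m|m|m|].
- exact: normr_ge0.
- exact: le_trans (aK m).
- exact: aK.
- by apply: is_cvg_geometric_series; rewrite ger0_norm ?invr_ge0 // invf_lt1 // ltr1n.
Qed.

Lemma cvg_inv_addn (n : T -> nat) (k : nat) : n @ F --> \oo ->
  (n t + k).+1%:R^-1 @[t --> F] --> (0 : R).
Proof.
move=> ninf; apply: (cvg_comp _ (fun m : nat => (m + k).+1%:R^-1 : R) ninf).
rewrite (cvg_shiftn k (fun m : nat => m.+1%:R^-1 : R)).
exact: cvg_harmonic.
Qed.

(** The product of (n+1) / (n+j) for 1 <= j <= m: what remains of n! / (m+n)! once y is rescaled to
    y / (n+1). It is at most 1 and tends to 1 as n grows. *)
Definition simplex_ratio (m n : nat) : R := n.+1%:R ^+ m * (n`!%:R / (m + n)`!%:R).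

Lemma simplex_ratioS m n :
  simplex_ratio m.+1 n = simplex_ratio m n * (n.+1%:R / (n + m).+1%:R).
Proof.
rewrite /simplex_ratio exprS addSn factS natrM [(n + m)%N]addnC.
have f0 : (m + n)`!%:R != 0 :> R by rewrite pnatr_eq0 -lt0n fact_gt0.
have f1 : (m + n).+1%:R != 0 :> R by rewrite pnatr_eq0.
move: (n.+1%:R : R) ((m + n).+1%:R : R) f1 => N M f1.
by field; rewrite f0 f1.
Qed.

Lemma simplex_ratio_itv m n : 0 <= simplex_ratio m n <= 1.
Proof.
elim: m => [|m /andP[h0 h1]].
  by rewrite /simplex_ratio expr0 mul1r add0n divff ?ler01 ?lexx // pnatr_eq0 -lt0n
    fact_gt0.
rewrite simplex_ratioS mulr_ge0 ?divr_ge0 //= mulr_ile1 ?divr_ge0 //.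
by rewrite ler_pdivrMr ?ltr0n // mul1r ler_nat ltnS leq_addr.
Qed.

Lemma simplex_ratio_cvg (n : T -> nat) m : n @ F --> \oo ->
  simplex_ratio m (n t) @[t --> F] --> (1 : R).
Proof.
move=> ninf; elim: m => [|m IH].
  under eq_cvg do rewrite /simplex_ratio expr0 mul1r add0n divff ?pnatr_eq0 -?lt0n
    ?fact_gt0 //.
  exact: cvg_cst.
under eq_cvg do rewrite simplex_ratioS.
suff h : (n t).+1%:R / (n t + m).+1%:R @[t --> F] --> (1 : R).
  by have := cvgM IH h; rewrite mulr1; apply.
have -> : (fun t => (n t).+1%:R / (n t + m).+1%:R) =
  (fun t => 1 - m%:R * (n t + m).+1%:R^-1 :> R).
  apply/funext => t; have f1 : (n t + m).+1%:R != 0 :> R by rewrite pnatr_eq0.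
  by apply: (mulIf f1); rewrite mulrBl !mulfVK // mul1r -addSn natrD addrK.
have h : m%:R * (n t + m).+1%:R^-1 @[t --> F] --> (m%:R * 0 : R).
  by apply: cvgMl_tmp; exact: cvg_inv_addn.
by have := cvgB (cvg_cst (1 : R)) h; rewrite mulr0 subr0; apply.
Qed.

(** With y of order N^(-1/2) and nodes of order N, the rescaled power sum b_j = (y/N)^j p_j is
    O(N^(1 - j/2)). So b_2 has a limit and the higher ones vanish, as [newton_cvg] and
    [newton_bound] require. *)
Lemma simplex_limit (n : T -> nat) (s : T -> seq R) (y : T -> R) (v c C : R) :
  (forall t, size (s t) = (n t).+1) ->
  (forall t, \sum_(a <- s t) a = 0) ->
  (\forall t \near F, forall a, a \in s t -> `|a| <= C * (n t).+1%:R) ->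
  n @ F --> \oo ->
  psum (s t) 2 / (n t).+1%:R ^+ 3 @[t --> F] --> v ->
  y t * Num.sqrt (n t).+1%:R @[t --> F] --> c ->
  exists val : T -> R,
    (\forall t \near F, series (simplex_term (s t) (n t) (y t)) @ \oo --> val t) /\
    val @ F --> expR (c ^+ 2 * v / 2).
Proof.
move=> ssz s0 sC ninf cv cy.
pose N t : R := (n t).+1%:R.
have N0 t : 0 < N t by rewrite ltr0n.
have Nn t : N t != 0 by rewrite gt_eqF.
pose b t j : R := (y t / N t) ^+ j * psum (s t) j.
pose B t m : R := (y t / N t) ^+ m * hsym (s t) m.
pose kap t : R := `|y t| * `|C|.
have cy2 : y t ^+ 2 * N t @[t --> F] --> c ^+ 2.
  rewrite (_ : (fun t => _) = (fun t => (y t * Num.sqrt (n t).+1%:R) ^+ 2)).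
    exact: cvg_pow.
  by apply/funext => t; rewrite exprMn sqr_sqrtr ?ler0n.
have y0 : y @ F --> (0 : R).
  rewrite (_ : y = (fun t => (y t * Num.sqrt (n t).+1%:R) * Num.sqrt ((n t).+1%:R^-1))).
    rewrite -(mulr0 c); apply: cvgM => //; rewrite -sqrtr0.
    apply: (cvg_comp _ (@Num.sqrt R)); last exact: sqrt_continuous.
    by have := cvg_inv_addn 0 ninf; under eq_cvg do rewrite addn0.
  by apply/funext => t; rewrite -mulrA -sqrtrM ?ler0n // divff ?sqrtr1 ?mulr1 // Nn.
have B0 t : B t 0%N = 1 by rewrite /B expr0 mul1r hsym0.
have Brec t m : m.+1%:R * B t m.+1 = \sum_(j < m.+1) b t j.+1 * B t (m - j)%N.
  rewrite /B mulrCA newton mulr_sumr; apply: eq_bigr => j _.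
  rewrite /b subSS mulrACA -exprD; congr (_ ^+ _ * _).
  by rewrite addSn subnKC // -ltnS.
have b1 t : b t 1%N = 0 by rewrite /b /psum (eq_bigr id) ?s0 ?mulr0.
have bw : b t 2%N @[t --> F] --> c ^+ 2 * v.
  rewrite (_ : (fun t => _) = (fun t => (y t ^+ 2 * N t) * (psum (s t) 2 / N t ^+ 3))).
    exact: cvgM.
  apply/funext => t; rewrite /b; have := Nn t; move: (N t) => M M0; by field.
(* y^2 N is eventually at most c^2 + 1, and |p_j| <= N (|C| N)^j because there are N nodes. *)
pose G := (c ^+ 2 + 1) * `|C| ^+ 2.
have bG : \forall t \near F, forall j, `|b t j.+2| <= G * kap t ^+ j.
  have yG : \forall t \near F, y t ^+ 2 * N t <= c ^+ 2 + 1.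
    have /cvgrPdist_le /(_ 1 ltr01) := cy2; apply: filterS => t H.
    rewrite -lerBlDl; apply: le_trans H; rewrite distrC; exact: ler_norm.
  apply: filterS2 yG sC => t yG sC j.
  have hp : `|psum (s t) j.+2| <= N t * (`|C| * N t) ^+ j.+2.
    rewrite /psum (le_trans (ler_norm_sum _ _ _)) //.
    apply: (@le_trans _ _ (\sum_(a <- s t) (`|C| * N t) ^+ j.+2)); last first.
      by rewrite big_const_seq count_predT iter_addr_0 ssz mulr_natl.
    rewrite big_seq [leRHS]big_seq; apply: ler_sum => a /sC aC.
    rewrite normrX lerXn2r ?nnegrE ?mulr_ge0 ?(ltW (N0 t)) //.
    by rewrite (le_trans aC) // ler_wpM2r ?ler_norm // ltW.
  have h2 : `|b t j.+2| <= (`|y t| / N t) ^+ j.+2 * (N t * (`|C| * N t) ^+ j.+2).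
    rewrite /b normrM normrX normrM normfV [`|N t|]gtr0_norm //.
    by rewrite ler_wpM2l // exprn_ge0 // divr_ge0 // ltW.
  rewrite (le_trans h2) //.
  have -> : (`|y t| / N t) ^+ j.+2 * (N t * (`|C| * N t) ^+ j.+2) =
     (y t ^+ 2 * N t) * `|C| ^+ 2 * kap t ^+ j.
    rewrite -real_normK ?num_real // /kap !exprMn exprVn -addn2 !exprD.
    by have := Nn t; move: (N t) => M M0; field; rewrite ?expf_neq0 ?M0.
  by rewrite !ler_wpM2r ?exprn_ge0 ?mulr_ge0.
have kap0 t : 0 <= kap t by rewrite mulr_ge0.
have kapl : kap @ F --> (0 : R).
  rewrite -(mul0r `|C|) -(normr0 R); apply: cvgMr_tmp; exact: cvg_norm.
have [K BK] := newton_bound B0 Brec b1 bG kap0 kapl.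
have Bc := @newton_cvg _ _ F FF _ _ _ _ _ B0 Brec b1 bw bG kapl.
have AE t m : simplex_term (s t) (n t) (y t) m = B t m * simplex_ratio m (n t).
  rewrite /simplex_term /B /simplex_ratio exprMn exprVn -/(N t).
  have x0 : N t ^+ m != 0 by rewrite expf_neq0.
  have f1 : (m + n t)`!%:R != 0 :> R by rewrite pnatr_eq0 -lt0n fact_gt0.
  move: (N t ^+ m) ((m + n t)`!%:R : R) x0 f1 => x z x0 z0.
  by field; rewrite ?x0 ?z0.
have AK : \forall t \near F, forall m, `|simplex_term (s t) (n t) (y t) m|
  <= K * 2^-1 ^+ m.
  apply: filterS BK => t BK m; rewrite AE normrM (le_trans _ (BK m)) //.
  by have /andP[h0 h1] := simplex_ratio_itv m (n t); rewrite ler_piMr // ger0_norm.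
exists (fun t => limn (series (simplex_term (s t) (n t) (y t)))).
have AV : \forall t \near F, series (simplex_term (s t) (n t) (y t)) @ \oo -->
    limn (series (simplex_term (s t) (n t) (y t))).
  by apply: filterS AK => t AK; exact: cvg_series_geometric_bound AK.
split=> //.
apply: (@tannery _ _ F FF (fun t => simplex_term (s t) (n t) (y t)) (gauss_coef (c ^+
  2 * v)) K _ _ _ AK AV); last exact: gauss_series.
move=> m; under eq_cvg do rewrite AE.
by have := cvgM (@Bc m) (simplex_ratio_cvg m ninf); rewrite mulr1; apply.
Qed.

End SimplexLimit.

(** * Integrals of decreasing functions *)

Section UnitInterval.
Variable R : realType.
Local Notation mu := (@lebesgue_measure R).
Local Notation I01 := (`[0, 1]%classic : set R).
Local Notation int01 f := (\int[@lebesgue_measure R]_(t in `[0, 1]) (f t)).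
Implicit Types f g : R -> R.

Definition bounded_measurable f : Prop :=
  measurable_fun I01 f /\ exists M, forall x, x \in `[0, 1] -> `|f x| <= M.

Lemma bmeasD f g : bounded_measurable f -> bounded_measurable g ->
  bounded_measurable (fun x => f x + g x).
Proof.
move=> [mf [M fM]] [mg [M' gM]]; split; first exact: measurable_funD.
by exists (M + M') => x xI; rewrite (le_trans (ler_normD _ _)) // lerD ?fM ?gM.
Qed.

Lemma bmeasM f g : bounded_measurable f -> bounded_measurable g ->
  bounded_measurable (fun x => f x * g x).
Proof.
move=> [mf [M fM]] [mg [M' gM]]; split; first exact: measurable_funM.
by exists (M * M') => x xI; rewrite normrM ler_pM ?fM ?gM.
Qed.

Lemma bmeas_cst c : bounded_measurable (fun=> c).
Proof. by split => //; exists `|c|. Qed.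

Lemma bmeas_id : bounded_measurable id.
Proof.
split => //; exists 1 => x; rewrite in_itv /= => /andP[x0 x1].
by rewrite ger0_norm.
Qed.

Lemma bmeas_decreasing f : weakly_decreasing f -> bounded_measurable f.
Proof.
move=> fd; split; last first.
  exists (`|f 0| + `|f 1|) => x xI; have := xI; rewrite in_itv /= => /andP[x0 x1].
  have h0 : f x <= f 0 by apply: fd => //; rewrite in_itv /= lexx ler01.
  have h1 : f 1 <= f x by apply: fd => //; rewrite in_itv /= lexx ler01.
  rewrite ler_norml; have := ler_norm (f 0); have := ler_norm (- f 1).
  have := normr_ge0 (f 0); have := normr_ge0 (f 1).
  by rewrite normrN => *; apply/andP; split; lra.
(* Monotonicity is known on [0, 1] only; composing with the retraction [clamp] gives a function
   decreasing on the whole line with the same values there. *)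
pose clamp x : R := Num.max 0 (Num.min 1 x).
have cI x : clamp x \in `[0, 1].
  by rewrite in_itv /= /clamp le_max lexx /= ge_max ler01 ge_min lexx.
apply: (@eq_measurable_fun _ _ _ _ _ (f \o clamp)).
  move=> x /set_mem; rewrite /= in_itv /= => /andP[x0 x1].
  by rewrite /clamp (min_idPr x1) (max_idPr x0).
apply: nonincreasing_measurable => // x y xy /=.
by apply: fd => //; rewrite /clamp le_max2 // le_min2.
Qed.

Lemma bmeas_integrable f : bounded_measurable f -> mu.-integrable I01 (EFin \o f).
Proof.
move=> [mf [M fM]]; apply: measurable_bounded_integrable => //.
  by rewrite /= lebesgue_measure_itv /= lte_fin ltr01 EFinN sube0 ltry.
exists M; split; first by rewrite num_real.
by move=> x Mx t /= tI; rewrite (le_trans (fM t _)) // ltW.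
Qed.

Lemma int01D f g : bounded_measurable f -> bounded_measurable g ->
  int01 (fun t => f t + g t) = int01 f + int01 g.
Proof. by move=> /bmeas_integrable hf /bmeas_integrable hg; rewrite RintegralD. Qed.

Lemma int01Z c f : bounded_measurable f -> int01 (fun t => c * f t) = c * int01 f.
Proof. by move=> /bmeas_integrable hf; rewrite RintegralZl. Qed.

Lemma int01_cst (c : R) : int01 (fun=> c) = c.
Proof.
by rewrite Rintegral_cst //= lebesgue_measure_itv /= lte_fin ltr01 oppr0 adde0 mulr1.
Qed.

Lemma int01_id : int01 id = 2^-1.
Proof.
have : int01 (fun x => 1 + (-1) * x) = 2^-1.
  rewrite -(Rintegral_onemXn 1); apply: eq_Rintegral => x _.
  by rewrite expr1 /unstable.onem mulN1r.
rewrite int01D; [|exact: bmeas_cst|by apply: bmeasM; [exact: bmeas_cst|exact: bmeas_id]].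
by rewrite int01_cst (int01Z _ bmeas_id); lra.
Qed.

Lemma int01_slice_bounds f a b lo hi : bounded_measurable f -> 0 <= a -> a <= b ->
  b <= 1 ->
  (forall t, a < t <= b -> lo <= f t <= hi) ->
  lo * (b - a) <= \int[mu]_(t in `[0, b]) f t - \int[mu]_(t in `[0, a]) f t
    <= hi * (b - a).
Proof.
move=> /bmeas_integrable fi a0 ab b1 fb.
have i0b : mu.-integrable `[0, b]%classic (EFin \o f).
  by apply: integrableS fi => //; apply: subset_itvl; rewrite bnd_simp.
have iab : mu.-integrable `]a, b]%classic (EFin \o f).
  by apply: integrableS i0b => //; apply: subset_itvr; rewrite bnd_simp.
rewrite Rintegral_itvB //.
have ic c : mu.-integrable `]a, b]%classic (EFin \o (fun=> c : R)).
  by apply: integrableS (bmeas_integrable (bmeas_cst c)) => //; apply: subset_itvScc;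
    rewrite bnd_simp.
have cst c : \int[mu]_(t in `]a, b]) c = c * (b - a).
  rewrite Rintegral_cst //= lebesgue_measure_itv /= lte_fin.
  by move: ab; rewrite le_eqVlt => /predU1P[->|ab]; rewrite ?ltxx ?subrr ?ab.
rewrite -!cst; apply/andP; split; apply: le_Rintegral => // t; rewrite /= in_itv /=;
  by move=> /fb /andP[].
Qed.

(** Monotonicity places the integral over each cell between the values at its ends, whose
    differences telescope. The resulting O(1/N) is negligible at the scale 1 / sqrt N of
    [mean_cvg]. *)
Lemma int01_riemann_sum f n : weakly_decreasing f ->
  `|int01 f - n.+1%:R^-1 * \sum_(i < n.+1) f (i.+1%:R / n.+1%:R)|
    <= (f 0 - f 1) / n.+1%:R.
Proof.
move=> fd; set N : R := n.+1%:R.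
have N0 : 0 < N by rewrite ltr0n.
pose P x : R := \int[mu]_(t in `[0, x]) f t.
have P0 : P 0 = 0 by rewrite /P set_itv1 Rintegral_set1.
have PN : P (n.+1%:R / N) = int01 f by rewrite /P divff // gt_eqF.
have tel : int01 f = \sum_(i < n.+1) (P (i.+1%:R / N) - P (i%:R / N)).
  by rewrite -(big_mkord xpredT (fun i => P (i.+1%:R / N) - P (i%:R / N)))
    (telescope_sumr (fun i => P (i%:R / N))) // PN mul0r P0 subr0.
have gap (i : 'I_n.+1) : f (i.+1%:R / N) / N <= P (i.+1%:R / N) - P (i%:R / N)
  <= f (i%:R / N) / N.
  have i0 : 0 <= i%:R / N by rewrite divr_ge0 // ltW.
  have i1 : i.+1%:R / N <= 1 by rewrite ler_pdivrMr // mul1r ler_nat.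
  have ii : i%:R / N <= i.+1%:R / N by rewrite ler_pM2r ?invr_gt0 // ler_nat.
  have E : i.+1%:R / N - i%:R / N = N^-1 by rewrite -mulrBl -natr1 addrAC subrr add0r
    mul1r.
  have := @int01_slice_bounds f _ _ (f (i.+1%:R / N)) (f (i%:R / N)) (bmeas_decreasing
    fd) i0 ii i1.
  rewrite E; apply.
  move: (i%:R / N) (i.+1%:R / N) i0 i1 ii => a b a0 b1 ab.
  move=> t /andP[h1 h2]; have h3 := ltW h1; apply/andP; split; apply: fd => //;
    rewrite in_itv /=; apply/andP; split; lra.
have hi : \sum_(i < n.+1) f (i%:R / N) / N = \sum_(i < n.+1) f (i.+1%:R / N) / N
  + (f 0 - f 1) / N.
  rewrite big_ord_recl [in RHS]big_ord_recr /= mul0r divff ?gt_eqF //.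
  under eq_bigr => i _ do rewrite /bump leq0n add1n.
  by ring.
have s1 : \sum_(i < n.+1) f (i.+1%:R / N) / N <= int01 f.
  by rewrite tel; apply: ler_sum => i _; have /andP[] := gap i.
have s2 : int01 f <= \sum_(i < n.+1) f (i.+1%:R / N) / N + (f 0 - f 1) / N.
  by rewrite -hi tel; apply: ler_sum => i _; have /andP[] := gap i.
rewrite [N^-1 * _]mulrC mulr_suml.
move: s1 s2; move: (int01 f) (\sum_(i < n.+1) _) ((f 0 - f 1) / N) => x y z s1 s2.
by rewrite ler_norml; apply/andP; split; lra.
Qed.

(** The right-hand side is Var f + 2 Cov(f, 1 - t), and since 1 - t has mean 1/2 the covariance term
    is the last integral of S(f). *)
Lemma Sf_var f : weakly_decreasing f ->
  Sf f = (int01 (fun t => (f t + (1 - t)) ^+ 2) - (int01 (fun t => f t + (1 - t))) ^+ 2)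
       - (int01 (fun t => (1 - t) ^+ 2) - (int01 (fun t => 1 - t)) ^+ 2).
Proof.
move=> /bmeas_decreasing bf.
have bg : bounded_measurable (fun t => 1 - t).
  have := bmeasD (bmeas_cst 1) (bmeasM (bmeas_cst (-1)) bmeas_id).
  by rewrite (_ : (fun x => _) = (fun t => 1 - t)) //; apply/funext => t; rewrite mulN1r.
have Ig : int01 (fun t => 1 - t) = 2^-1.
  have := int01D (bmeas_cst 1) (bmeasM (bmeas_cst (-1)) bmeas_id).
  rewrite int01_cst (int01Z _ bmeas_id) int01_id.
  rewrite (_ : (fun x => _) = (fun t => 1 - t)) => [->|]; first by lra.
  by apply/funext => t; rewrite mulN1r.
have bff := bmeasM bf bf; have bfg := bmeasM bf bg; have bgg := bmeasM bg bg.
have -> : int01 (fun t => (f t + (1 - t)) ^+ 2) =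
  int01 (fun t => f t * f t) + 2 * int01 (fun t => f t * (1 - t))
    + int01 (fun t => (1 - t) * (1 - t)).
  rewrite -(int01Z _ bfg) -int01D //; last by apply: bmeasM => //; exact: bmeas_cst.
  rewrite -int01D //; last by apply: bmeasD => //; apply: bmeasM => //; exact: bmeas_cst.
  by apply: eq_Rintegral => t _; ring.
have -> : int01 (fun t => (1 - t) ^+ 2) = int01 (fun t => (1 - t) * (1 - t)).
  by apply: eq_Rintegral => t _; rewrite expr2.
rewrite (int01D bf bg) Ig /Sf -/(Ef f).
have -> : int01 (fun t => f t ^+ 2) = int01 (fun t => f t * f t).
  by apply: eq_Rintegral => t _; rewrite expr2.
have -> : int01 (fun t => f t * (1 - 2 * t)) = 2 * int01 (fun t => f t * (1 - t))
  + (-1) * int01 f.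
  rewrite -(int01Z _ bfg) -(int01Z _ bf) -int01D //; try by apply: bmeasM => //;
    exact: bmeas_cst.
  by apply: eq_Rintegral => t _; ring.
by rewrite /Ef; field.
Qed.

(** The last integral of S(f) is the covariance of f with the decreasing function 1 - 2t, positive
    by Chebyshev's argument. Strictness needs a set of positive length where f differs from f(1/2);
    interior points provide it. *)
Lemma Sf_gt0 f : weakly_decreasing f -> nonconstant f -> 0 < Sf f.
Proof.
move=> fd [x0 [y0 [xI yI nxy]]].
wlog lt_xy : x0 y0 xI yI nxy / x0 < y0.
  move=> W; case: (ltgtP x0 y0) => [||e]; [exact: W|by apply: W => //; rewrite eq_sym|].
  by rewrite e eqxx in nxy.
move: xI yI; rewrite !in_itv /= => /andP[x00 x01] /andP[y00 y01].
have fxy : f y0 < f x0.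
  rewrite lt_neqAle eq_sym nxy /=; apply: fd; rewrite ?in_itv /= ?ltW //.
have xI : x0 \in `[0, 1] by rewrite in_itv /= !ltW.
have yI : y0 \in `[0, 1] by rewrite in_itv /= !ltW.
have bf := bmeas_decreasing fd.
have bg : bounded_measurable (fun t => 1 - 2 * t).
  have := bmeasD (bmeas_cst 1) (bmeasM (bmeas_cst (-2)) bmeas_id).
  by rewrite (_ : (fun x => _) = (fun t => 1 - 2 * t)) //; apply/funext => t;
    rewrite mulNr.
have Ig : int01 (fun t => 1 - 2 * t) = 0.
  have := int01D (bmeas_cst 1) (bmeasM (bmeas_cst (-2)) bmeas_id).
  rewrite int01_cst (int01Z _ bmeas_id) int01_id.
  rewrite (_ : (fun x => _) = (fun t => 1 - 2 * t)) => [->|]; first by lra.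
  by apply/funext => t; rewrite mulNr.
have bc c := bmeas_cst c.
have var0 : 0 <= int01 (fun t => f t ^+ 2) - Ef f ^+ 2.
  have : 0 <= int01 (fun t => (f t - Ef f) ^+ 2) by apply: Rintegral_ge0 => t _;
    exact: sqr_ge0.
  suff -> : int01 (fun t => (f t - Ef f) ^+ 2) =
    int01 (fun t => f t ^+ 2) - Ef f ^+ 2 by [].
  have -> : int01 (fun t => f t ^+ 2) = int01 (fun t => f t * f t).
    by apply: eq_Rintegral => t _; rewrite expr2.
  transitivity (int01 (fun t => f t * f t + ((-2 * Ef f) * f t + Ef f ^+ 2))).
    by apply: eq_Rintegral => t _; ring.
  rewrite int01D; [|exact: bmeasM|by apply: bmeasD => //; exact: bmeasM].
  by rewrite int01D ?int01Z ?int01_cst -/(Ef f) //; [ring|exact: bmeasM].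
suff : 0 < int01 (fun t => f t * (1 - 2 * t)) by rewrite /Sf; lra.
(* Since 1 - 2t has integral 0, one may subtract f(1/2), which makes the
   integrand nonnegative. *)
pose G t := (f t - f 2^-1) * (1 - 2 * t).
have bG : bounded_measurable G.
  by apply: bmeasM => //; apply: (bmeasD bf (bc (- f 2^-1))).
have -> : int01 (fun t => f t * (1 - 2 * t)) = int01 G.
  transitivity (int01 (fun t => G t + f 2^-1 * (1 - 2 * t))).
    by apply: eq_Rintegral => t _; rewrite /G; ring.
  by rewrite int01D ?int01Z ?Ig ?mulr0 ?addr0 //; exact: bmeasM.
have hI : (2^-1 : R) \in `[0, 1] by rewrite in_itv /=; apply/andP; split; lra.
have G0 t : t \in `[0, 1] -> 0 <= G t.
  move=> tI; rewrite /G; have [th|ht] := leP t 2^-1.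
    by have := fd _ _ tI hI th => ?; apply: mulr_ge0; lra.
  by have := fd _ _ hI tI (ltW ht) => ?; apply: mulr_le0; lra.
have Gub : exists M, forall t, t \in `[0, 1] -> G t <= M.
  by have [_ [M HM]] := bG; exists M => t /HM; apply: le_trans; exact: ler_norm.
have [M GM] := Gub.
have P0 : \int[mu]_(t in `[0, 0]) G t = 0 by rewrite set_itv1 Rintegral_set1.
(* Either f(x0) or f(y0) differs from f(1/2), and [G] is then bounded below by a positive constant
   on ]0, x0] or on ]y0, 1]. *)
have [fh|fh] := ltP (f 2^-1) (f x0).
  have xh : x0 < 2^-1.
    by rewrite ltNge; apply/negP => hx; have := fd _ _ hI xI hx; lra.
  have g1 t : 0 < t <= x0 -> (f x0 - f 2^-1) * (1 - 2 * x0) <= G t <= M.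
    move=> /andP[t0 tx]; have tI : t \in `[0, 1] by rewrite in_itv /=; apply/andP;
      split; lra.
    rewrite GM // andbT; have : f x0 <= f t by apply: fd.
    by move=> ?; apply: ler_pM; lra.
  have g2 t : x0 < t <= 1 -> 0 <= G t <= M.
    move=> /andP[t0 tx]; have tI : t \in `[0, 1] by rewrite in_itv /=; apply/andP;
      split; lra.
    by rewrite GM // G0.
  have /andP[h1 _] := int01_slice_bounds bG (lexx _) (ltW x00) (ltW x01) g1.
  have /andP[h2 _] := int01_slice_bounds bG (ltW x00) (ltW x01) (lexx _) g2.
  rewrite P0 in h1; have : 0 < (f x0 - f 2^-1) * (1 - 2 * x0) * (x0 - 0).
    by apply: mulr_gt0; [apply: mulr_gt0|]; lra.
  by lra.
have fh' : f y0 < f 2^-1 by lra.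
have xh : 2^-1 < y0.
  by rewrite ltNge; apply/negP => hx; have := fd _ _ yI hI hx; lra.
have g1 t : 0 < t <= y0 -> 0 <= G t <= M.
  move=> /andP[t0 tx]; have tI : t \in `[0, 1] by rewrite in_itv /=; apply/andP;
    split; lra.
  by rewrite GM // G0.
have g2 t : y0 < t <= 1 -> (f 2^-1 - f y0) * (2 * y0 - 1) <= G t <= M.
  move=> /andP[t0 tx]; have tI : t \in `[0, 1] by rewrite in_itv /=; apply/andP;
    split; lra.
  rewrite GM // andbT; have : f t <= f y0 by apply: fd => //; exact: ltW.
  move=> ?; rewrite /G (_ : (f t - f 2^-1) * (1 - 2 * t) =
    (f 2^-1 - f t) * (2 * t - 1)); last by ring.
  by apply: ler_pM; lra.
have /andP[h1 _] := int01_slice_bounds bG (lexx _) (ltW y00) (ltW y01) g1.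
have /andP[h2 _] := int01_slice_bounds bG (ltW y00) (ltW y01) (lexx _) g2.
rewrite P0 in h1; have : 0 < (f 2^-1 - f y0) * (2 * y0 - 1) * (1 - y0).
  by apply: mulr_gt0; [apply: mulr_gt0|]; lra.
by lra.
Qed.

End UnitInterval.

(** * Schur functions as pattern sums *)

Section SchurGT.
Variable R : realType.

Lemma GT_eq n lam (u v : nat -> R) : (forall i, (i < n)%N -> u i = v i) ->
  GT n lam u = GT n lam v.
Proof.
elim: n lam u v => [//|n IH] lam u v uv; rewrite !GTS.
apply: eq_bigr => d _; rewrite uv //; congr (_ * _).
by apply: IH => i lin; rewrite uv.
Qed.

Lemma cvg_exprz (T : Type) (F : set_system T) (FF : Filter F) (f : T ->
  R) (a : R) (z : int) :
  a != 0 -> f @ F --> a -> f t ^ z @[t --> F] --> a ^ z.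
Proof.
move=> a0 fa; case: z => m.
  by under eq_cvg do rewrite -exprnP; rewrite -exprnP; exact: cvg_pow.
rewrite NegzE; under eq_cvg do rewrite -exprnN; rewrite -exprnN.
by apply: cvgV; [rewrite expf_neq0|exact: cvg_pow].
Qed.

Lemma GT_cvg (T : Type) (F : set_system T) (FF : Filter F) n lam (u : T -> nat ->
  R) (a : nat -> R) :
  (forall i, (i < n)%N -> u t i @[t --> F] --> a i) ->
  (forall i, (i < n)%N -> a i != 0) ->
  GT n lam (u t) @[t --> F] --> GT n lam a.
Proof.
elim: n lam u a => [|n IH] lam u a ua a0; first exact: cvg_cst.
under eq_cvg do rewrite GTS; rewrite GTS.
apply: cvg_big => [|d _]; first exact: add_continuous.
apply: cvgM; first by apply: cvg_exprz; [exact: a0|exact: ua].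
by apply: (IH _ (fun t i => u t i.+1) (fun i => a i.+1)) => i lin; [exact: ua|exact: a0].
Qed.

Definition seq_of_fun (V : Type) (x0 : V) N (g : 'I_N -> V) (i : nat) : V :=
  oapp g x0 (insub i).

Lemma seq_of_funE (V : Type) (x0 : V) N (g : 'I_N -> V) (i : 'I_N) :
  seq_of_fun x0 g i = g i.
Proof. by rewrite /seq_of_fun valK. Qed.

Lemma seq_of_fun_lt (V : Type) (x0 : V) N (g : 'I_N -> V) i (lti : (i < N)%N) :
  seq_of_fun x0 g i = g (Ordinal lti).
Proof. by rewrite /seq_of_fun insubT. Qed.

Lemma signature_is_sig N (lam : 'I_N -> int) : signature lam ->
  is_sig N (seq_of_fun 0 lam).
Proof.
by move=> ls j jN; rewrite (seq_of_fun_lt _ _ (ltnW jN)) (seq_of_fun_lt _ _ jN) ls /=.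
Qed.

Lemma schur_ratio_GT N (lam : 'I_N -> int) (v : 'rV[R]_N) :
  signature lam -> (forall i, v 0 i != 0) -> injective (v 0) ->
  schur_ratio lam v = GT N (seq_of_fun 0 lam) (seq_of_fun 1 (v 0)).
Proof.
move=> ls v0 vinj; have dl := signature_is_sig ls.
have nz i : (i < N)%N -> seq_of_fun 1 (v 0) i != 0.
  by move=> lin; rewrite seq_of_fun_lt v0.
have := alternant_GT dl nz; rewrite /schur_ratio.
have -> : \prod_(i < N) \prod_(j < N | (i < j)%N) (seq_of_fun 1 (v 0) i - seq_of_fun 1
  (v 0) j)
   = \prod_(i < N) \prod_(j < N | (i < j)%N) (v 0 i - v 0 j).
  by apply: eq_bigr => i _; apply: eq_bigr => j _; rewrite !seq_of_funE.
have -> : \matrix_(i, j) seq_of_fun 1 (v 0) i ^ shifted N (seq_of_fun 0 lam) j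
   = \matrix_(i < N, j < N) v 0 i ^ (lam j + (N - j.+1)%N%:Z).
  by apply/matrixP => i j; rewrite !mxE /shifted !seq_of_funE.
move=> ->; rewrite mulfK //; apply/prodf_neq0 => i _; apply/prodf_neq0 => j ij.
rewrite subr_eq0; apply/eqP => /vinj e; by rewrite e ltnn in ij.
Qed.

(** Properness makes the [lim] in [schur] unique. Along u + e (0, 1, 2, ...) two coordinates collide
    for finitely many e only. *)
Lemma within_injective_proper N (u : 'rV[R]_N) :
  ProperFilter (within [set v : 'rV[R]_N | injective (v 0)] (nbhs u)).
Proof.
apply: Build_ProperFilter => uA.
pose w (e : R) : 'rV[R]_N := u + e *: \row_(i < N) i%:R.
have cw : w e @[e --> (0 : R)] --> u.
  have : w e @[e --> (0 : R)] --> u + 0 *: \row_(i < N) i%:R.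
    by apply: cvgD; [exact: cvg_cst|apply: cvgZr_tmp; exact: cvg_id].
  by rewrite scale0r addr0.
have /nbhs_ballP[e /= e0 eA] := cw _ uA.
(* [bad] lists the parameters at which two coordinates meet. The minimum [m] starts from the radius
   of the ball, so that m / 2 stays inside it and below every positive bad parameter. *)
pose bad : seq R := [seq (u 0 p.1 - u 0 p.2) / (p.2%:R - p.1%:R) | p : 'I_N * 'I_N].
pose m := \big[Num.min/e]_(b <- bad | 0 < b) b.
have m0 : 0 < m by rewrite /m; elim/big_ind: _ => // x y x0 y0; rewrite lt_min x0.
apply: (eA (m / 2)).
  rewrite /ball /= sub0r normrN gtr0_norm ?divr_gt0 //.
  have : m <= e by rewrite /m; elim/big_rec: _ => // b x _ xe; rewrite ge_min xe orbT.
  by lra.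
move=> i j /eqP; rewrite !mxE => /eqP wij; apply/eqP/negPn/negP => nij.
have ij : j%:R - i%:R != 0 :> R.
  by rewrite subr_eq0 eqr_nat; apply: contra nij => /eqP/val_inj ->.
have E : m / 2 = (u 0 i - u 0 j) / (j%:R - i%:R).
  by apply: (mulIf ij); rewrite divfK //; lra.
have : m <= m / 2.
  have bin : m / 2 \in bad by rewrite E; apply/mapP; exists (i, j); rewrite ?mem_enum.
  rewrite {1}/m; have mp : 0 < m / 2 by rewrite divr_gt0.
  elim: (bad) bin => // b s IH; rewrite in_cons big_cons => /orP[/eqP <-|/IH h].
    by rewrite mp ge_min lexx.
  by case: ifP => _ //; rewrite ge_min h orbT.
by lra.
Qed.

(** The pattern sum is continuous at positive points, negative powers included, and it agrees with
    the quotient of determinants at all nearby points with distinct coordinates. *)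
Lemma schur_GT N (lam : 'I_N -> int) (u : 'rV[R]_N) :
  signature lam -> (forall i, 0 < u 0 i) ->
  schur lam u = GT N (seq_of_fun 0 lam) (seq_of_fun 1 (u 0)).
Proof.
move=> ls u0; have PF := within_injective_proper u.
have cc i : v 0 i @[v --> u] --> u 0 i by exact: coord_continuous.
have c1 : GT N (seq_of_fun 0 lam) (seq_of_fun 1 ((v : 'rV[R]_N) 0)) @[v --> u] -->
    GT N (seq_of_fun 0 lam) (seq_of_fun 1 (u 0)).
  apply: (@GT_cvg _ _ (nbhs_filter u) _ _ (fun v : 'rV[R]_N => seq_of_fun 1 (v 0))) =>
    i lin;
    rewrite seq_of_fun_lt ?gt_eqF //.
  by under eq_cvg do rewrite seq_of_fun_lt; exact: cc.
rewrite /schur; apply/cvg_lim => //.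
have c2 := @cvg_within_filter _ _ _ _ (nbhs_filter u) _
  [set v : 'rV[R]_N | injective (v 0)] c1.
apply: cvg_trans c2; apply: near_eq_cvg.
rewrite /prop_near1 /within /=.
have pos : \forall v \near u, forall i, 0 < (v : 'rV[R]_N) 0 i.
  apply: (@filter_forall _ _ (fun i (v : 'rV[R]_N) => 0 < v 0 i) _ (nbhs_filter u)) =>
    i; move: (cc i) => cci.
  exact: (@cvgr_gt _ _ _ (nbhs_filter u) (fun v : 'rV[R]_N => v 0 i) _ cci _ (u0 i)).
apply: filterS pos => v vp vinj; rewrite schur_ratio_GT // => i.
by rewrite gt_eqF.
Qed.

End SchurGT.

(** * Limit profiles *)

Section Profiles.
Variable R : realType.
Local Notation int01 f := (\int[@lebesgue_measure R]_(t in `[0, 1]) (f t)).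

Section Averages.
Variables (T : Type) (F : set_system T).
Context {FF : Filter F}.
Variable n : T -> nat.
Hypothesis ninf : n @ F --> \oo.
Let N t : R := (n t).+1%:R.
Let N0 t : 0 < N t. Proof. by rewrite ltr0n. Qed.
Let avg (x : T -> nat -> R) t := (N t)^-1 * \sum_(i < (n t).+1) x t i.

Lemma cvg_invN : (N t)^-1 @[t --> F] --> (0 : R).
Proof. by have := @cvg_inv_addn R T F n 0 ninf; under eq_cvg do rewrite addn0. Qed.

Lemma cvg_inv_sqrtN : (Num.sqrt (N t))^-1 @[t --> F] --> (0 : R).
Proof.
under eq_cvg do rewrite -sqrtrV ?ler0n //.
suff : Num.sqrt (N t)^-1 @[t --> F] --> Num.sqrt (0 : R) by rewrite sqrtr0.
by apply: (cvg_comp _ (@Num.sqrt R) cvg_invN); exact: sqrt_continuous.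
Qed.

Lemma avg_cvg x g : weakly_decreasing g ->
  avg (fun t i => `|x t i - g (i.+1%:R / N t)|) @ F --> (0 : R) ->
  avg x @ F --> int01 g.
Proof.
move=> gd x0; apply/subr_cvg0.
apply: norm_cvg0.
apply: (@squeeze_cvgr _ _ _ _ (fun=> 0)
  (fun t => avg (fun t i => `|x t i - g (i.+1%:R / N t)|) t + (g 0 - g 1) * (N t)^-1)).
- apply: filterE => t; rewrite normr_ge0 /=.
  have := int01_riemann_sum (n t) gd; set S := \sum_(i < _) _ => h.
  have -> : avg x t - int01 g = (N t)^-1 * \sum_(i < (n t).+1) (x t i - g (i.+1%:R / N t))
     + ((N t)^-1 * S - int01 g).
    by rewrite sumrB -/S /avg; ring.
  rewrite (le_trans (ler_normD _ _)) // lerD //; last by rewrite distrC.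
  rewrite normrM gtr0_norm ?invr_gt0 // ler_wpM2l ?invr_ge0 ?(ltW (N0 t)) //.
  exact: ler_norm_sum.
- exact: cvg_cst.
- have h : (g 0 - g 1) * (N t)^-1 @[t --> F] --> ((g 0 - g 1) * 0 : R).
    by apply: cvgMl_tmp; exact: cvg_invN.
  by have := cvgD x0 h; rewrite mulr0 addr0; apply.
Qed.

Lemma avg_sqr_cvg x g C : weakly_decreasing g ->
  avg (fun t i => `|x t i - g (i.+1%:R / N t)|) @ F --> (0 : R) ->
  (\forall t \near F, forall i, (i < (n t).+1)%N -> `|x t i| <= C) ->
  avg (fun t i => x t i ^+ 2) @ F --> int01 (fun t => g t ^+ 2).
Proof.
move=> gd x0 xC.
(* Unlike g ^+ 2, the square of g - g 1 >= 0 is again decreasing. *)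
pose g2 t := (g t - g 1) ^+ 2.
have g1g t : t \in `[0, 1] -> g 1 <= g t.
  move=> tI; apply: gd => //; first by rewrite in_itv /= ler01 lexx.
  by move: tI; rewrite in_itv /= => /andP[].
have gg0 t : t \in `[0, 1] -> g t <= g 0.
  move=> tI; apply: gd => //; first by rewrite in_itv /= ler01 lexx.
  by move: tI; rewrite in_itv /= => /andP[].
have g2d : weakly_decreasing g2.
  move=> s t sI tI st; rewrite /g2 lerXn2r ?nnegrE ?subr_ge0 ?g1g //.
  by rewrite lerD2r gd.
(* A bound for |x + g - 2 g(1)|, the cofactor of x - g in the difference of the squares. *)
pose K := `|C| + `|g 0| + 3 * `|g 1|.
have x2 : avg (fun t i => (x t i - g 1) ^+ 2) @ F --> int01 g2.
  apply: avg_cvg => //.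
  apply: (@squeeze_cvgr _ _ _ _ (fun=> 0)
    (fun t => K * avg (fun t i => `|x t i - g (i.+1%:R / N t)|) t)).
  - apply: filterS xC => t xC; rewrite /avg mulrCA.
    rewrite mulr_ge0 ?invr_ge0 ?(ltW (N0 t)) ?sumr_ge0 //=.
    rewrite ler_wpM2l ?invr_ge0 ?(ltW (N0 t)) // mulr_sumr; apply: ler_sum => i _.
    have iI : i.+1%:R / N t \in `[0, 1].
      by rewrite in_itv /= divr_ge0 ?(ltW (N0 t)) //= ler_pdivrMr // mul1r ler_nat.
    move: (xC i (ltn_ord i)) (g1g _ iI) (gg0 _ iI); rewrite /g2.
    move: (g (i.+1%:R / N t)) (x t i) => y z zC y1 y0.
    rewrite subr_sqr normrM mulrC.
    have -> : z - g 1 - (y - g 1) = z - y by ring.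
    rewrite ler_wpM2r //.
    have := ler_norm (g 0); have := ler_norm (- g 1); have := ler_norm (g 1).
    have := ler_norm C; have := ler_norm z; have := ler_norm (- z).
    have := normr_ge0 (g 0); have := normr_ge0 (g 1).
    rewrite !normrN => *; rewrite /K ler_norml; apply/andP; split; lra.
  - exact: cvg_cst.
  - have h : K * avg (fun t i => `|x t i - g (i.+1%:R / N t)|) t @[t --> F] --> (K * 0
      : R).
      by apply: cvgMl_tmp.
    by rewrite mulr0 in h.
have bg := bmeas_decreasing gd; have bg1 := bmeas_cst (- g 1).
have bgg := bmeas_decreasing g2d.
have -> : int01 (fun t => g t ^+ 2) = int01 g2 + (2 * g 1 * int01 g + (- g 1 ^+ 2)).
  rewrite -(int01Z _ bg) -[X in _ = _ + (_ + X)]int01_cst -int01D; last 2 first.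
  - by apply: bmeasM => //; exact: bmeas_cst.
  - exact: bmeas_cst.
  rewrite -int01D //; last first.
    apply: bmeasD; [by apply: bmeasM => //; exact: bmeas_cst|exact: bmeas_cst].
  by apply: eq_Rintegral => t _; rewrite /g2; ring.
have -> : avg (fun t i => x t i ^+ 2) = (fun t => avg (fun t i => (x t i - g 1) ^+ 2) t
   + (2 * g 1 * avg x t + (- g 1 ^+ 2))).
  apply/funext => t; rewrite /avg.
  have -> : - g 1 ^+ 2 = (N t)^-1 * \sum_(i < (n t).+1) (- g 1 ^+ 2).
    by rewrite sumr_const card_ord -[_ *+ _]mulr_natl mulKf // gt_eqF.
  rewrite [2 * g 1 * _]mulrCA -!mulrDr; congr (_ * _).
  by rewrite mulr_sumr -!big_split /=; apply: eq_bigr => i _; ring.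
apply: cvgD => //; apply: cvgD; last exact: cvg_cst.
by apply: cvgMl_tmp; exact: avg_cvg.
Qed.

End Averages.

Section Approximation.
Variables (T : Type) (F : set_system T).
Context {FF : Filter F}.

(** The hypotheses of the theorem, for size n + 1 and only eventually along [F]: in this form they
    pass to interlacing signatures ([approximates_lowering]). *)
Definition approximates (n : T -> nat) (lam : T -> nat -> int) (f : R -> R) : Prop :=
  [/\ n @ F --> \oo,
      \forall t \near F, is_sig (n t).+1 (lam t),
      forall e, 0 < e -> \forall t \near F,
        \sum_(i < (n t).+1) `|(lam t i)%:~R / (n t).+1%:R - f (i.+1%:R / (n t).+1%:R)|
        <= e * Num.sqrt (n t).+1%:R
    & exists C : R, \forall t \near F, forall i, (i < (n t).+1)%N ->
        `|(lam t i)%:~R| <= C * (n t).+1%:R].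

Variables (n : T -> nat) (lam : T -> nat -> int) (f : R -> R).
Hypotheses (fd : weakly_decreasing f) (lf : approximates n lam f).
Let N t : R := (n t).+1%:R.
Let N0 t : 0 < N t. Proof. by rewrite ltr0n. Qed.
Let sN0 t : 0 < Num.sqrt (N t). Proof. by rewrite sqrtr_gt0. Qed.
Let sNN t : Num.sqrt (N t) * Num.sqrt (N t) = N t.
Proof. by rewrite -expr2 sqr_sqrtr // ltW. Qed.

(** The l1-hypothesis divided by N gives o(1 / sqrt N) and the Riemann sum errs by O(1 / N); both
    still vanish after multiplication by sqrt N. *)
Lemma mean_cvg :
  Num.sqrt (N t) * ((weight (n t).+1 (lam t))%:~R / N t ^+ 2 - int01 f) @[t --> F] -->
    (0 : R).
Proof.
have [ninf _ lamf _] := lf.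
apply/cvgrPdist_le => e e0; have e2 : 0 < e / 2 by rewrite divr_gt0.
have h : (f 0 - f 1) * (Num.sqrt (N t))^-1 @[t --> F] --> ((f 0 - f 1) * 0 : R).
  by apply: cvgMl_tmp; exact: cvg_inv_sqrtN.
rewrite mulr0 in h.
have {}h : \forall t \near F, (f 0 - f 1) / Num.sqrt (N t) <= e / 2.
  have /cvgrPdist_le /(_ _ e2) := h; apply: filterS => t.
  by rewrite sub0r normrN; apply: le_trans; exact: ler_norm.
apply: filterS2 (lamf _ e2) h => t; rewrite -/(N t) => h1 h2.
rewrite sub0r normrN normrM gtr0_norm //.
have := int01_riemann_sum (n t) fd; rewrite -/(N t); set S := \sum_(i < _) f _ => hS.
set L := \sum_(i < _) _ in h1.
have hL : `|(weight (n t).+1 (lam t))%:~R / N t ^+ 2 - (N t)^-1 * S| <= (N t)^-1 * L.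
  have -> : (weight (n t).+1 (lam t))%:~R / N t ^+ 2 - (N t)^-1 * S
     = (N t)^-1 * \sum_(i < (n t).+1) ((lam t i)%:~R / N t - f (i.+1%:R / N t)).
    rewrite sumrB -/S -mulr_suml /weight rmorph_sum /= mulrBr.
    by have := lt0r_neq0 (N0 t); move: (N t) => M M0; congr (_ - _); field.
  rewrite normrM gtr0_norm ?invr_gt0 // ler_wpM2l ?invr_ge0 ?(ltW (N0 t)) //.
  exact: ler_norm_sum.
have hT : `|(weight (n t).+1 (lam t))%:~R / N t ^+ 2 - int01 f| <= (N t)^-1 * L
  + (f 0 - f 1) / N t.
  rewrite (le_trans (ler_distD ((N t)^-1 * S) _ _)) // lerD //; by rewrite distrC.
rewrite (le_trans (ler_wpM2l (ltW (sN0 t)) hT)) //.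
have -> : Num.sqrt (N t) * ((N t)^-1 * L + (f 0 - f 1) / N t)
   = L / Num.sqrt (N t) + (f 0 - f 1) / Num.sqrt (N t).
  by have := sNN t; have := lt0r_neq0 (sN0 t); move: (Num.sqrt (N t)) => M M0 <-; field.
have -> : e = e / 2 + e / 2 by field.
by rewrite lerD // ler_pdivrMr.
Qed.

Definition mean_shifted t : R := (\sum_(i < (n t).+1) (shifted (n t).+1 (lam t)
  i)%:~R) / N t.

Definition profile_var : R :=
  int01 (fun t => (f t + (1 - t)) ^+ 2) - (int01 (fun t => f t + (1 - t))) ^+ 2.

Lemma simplex_nodes_limit (y : T -> R) (c : R) :
  y t * Num.sqrt (N t) @[t --> F] --> c ->
  exists val : T -> R,
    (\forall t \near F,
       series (simplex_term (nodes (n t).+1 (lam t) (mean_shifted t)) (n t) (y t)) @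
         \oo --> val t) /\
    val @ F --> expR (c ^+ 2 * profile_var / 2).
Proof.
move=> cy; have [ninf _ lamf [C lamC]] := lf.
(* Counting from 1, l_i / N = lambda_i / N + 1 - i / N, whose profile is f(t) + (1 - t). *)
pose g t := f t + (1 - t).
have gd : weakly_decreasing g.
  by move=> s t sI tI st; rewrite /g lerD ?fd // lerD2l lerN2.
pose x t i : R := (shifted (n t).+1 (lam t) i)%:~R / N t.
pose K := C + 1.
have xE t (i : nat) : (i < (n t).+1)%N -> x t i =
  (lam t i)%:~R / N t + (1 - i.+1%:R / N t).
  move=> iN; rewrite /x /shifted rmorphD /= -pmulrn natrB // -/(N t).
  by have := lt0r_neq0 (N0 t); move: (N t) => M M0; field.
have xK : \forall t \near F, forall i, (i < (n t).+1)%N -> `|x t i| <= K.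
  apply: filterS lamC => t lamC i iN; rewrite xE // (le_trans (ler_normD _ _)) // lerD //.
    by rewrite normrM normfV [`|N t|]gtr0_norm // ler_pdivrMr // lamC.
  have i1 : i.+1%:R / N t <= 1 by rewrite ler_pdivrMr // mul1r ler_nat.
  have i0 : 0 <= i.+1%:R / N t by rewrite divr_ge0 // ltW.
  by move: (i.+1%:R / N t) i0 i1 => z z0 z1; rewrite ger0_norm; lra.
have x0 : (N t)^-1 * \sum_(i < (n t).+1) `|x t i - g (i.+1%:R / N t)| @[t --> F] -->
  (0 : R).
  apply/cvgrPdist_le => e e0; apply: filterS (lamf _ e0) => t h.
  rewrite sub0r normrN ger0_norm; last by rewrite mulr_ge0 ?sumr_ge0 // invr_ge0 ltW.
  rewrite mulrC ler_pdivrMr // (eq_bigr (fun i : 'I_(n t).+1 =>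
     `|(lam t i)%:~R / N t - f (i.+1%:R / N t)|)); last first.
    by move=> i _; rewrite xE // /g; congr `|_|; ring.
  rewrite (le_trans h) // ler_wpM2l ?(ltW e0) // -/(N t).
  by rewrite -{2}(sNN t) ler_peMl ?(ltW (sN0 t)) // -(sqrtr1 R) ler_wsqrtr // ler1n.
have c1 := @avg_cvg _ _ FF _ ninf _ _ gd x0.
have c2 := @avg_sqr_cvg _ _ FF _ ninf _ _ _ gd x0 xK.
have sum_nodes t (h : R -> R) : \sum_(a <- nodes (n t).+1 (lam t) (mean_shifted t)) h a
   = \sum_(i < (n t).+1) h (N t * x t i - mean_shifted t).
  rewrite /nodes big_map -[iota _ _]/(index_iota 0 (n t).+1) big_mkord.
  apply: eq_bigr => i _; rewrite /x; congr (h (_ - _)).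
  by rewrite mulrC divfK // gt_eqF.
have mE t : mean_shifted t = \sum_(i < (n t).+1) x t i by rewrite /mean_shifted mulr_suml.
(* K + K bounds a centred node over N: K for the entry and K for the mean. *)
apply: (@simplex_limit R T F FF n _ y profile_var c (K + K)) => //.
- by move=> t; rewrite size_nodes.
- move=> t; rewrite (sum_nodes t id) sumrB sumr_const card_ord -mulr_sumr -mE.
  by rewrite -[_ *+ _]mulr_natl subrr.
- apply: filterS xK => t xK a /mapP[i]; rewrite mem_iota add0n /= => iN ->.
  have -> : (shifted (n t).+1 (lam t) i)%:~R = N t * x t i.
    by rewrite /x mulrC divfK // gt_eqF.
  rewrite mulrDl -/(N t) (le_trans (ler_normB _ _)) // lerD //.
    by rewrite normrM gtr0_norm // mulrC ler_wpM2r ?xK // ltW.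
  rewrite mE (le_trans (ler_norm_sum _ _ _)) //.
  apply: (@le_trans _ _ (\sum_(j < (n t).+1) K)).
    by apply: ler_sum => j _; exact: xK.
  by rewrite sumr_const card_ord -[_ *+ _]mulr_natr.
have c12 : ((n t).+1%:R^-1 * \sum_(i < (n t).+1) x t i) ^+ 2 @[t --> F] --> (int01 g)
  ^+ 2.
  exact: cvg_pow.
(* After division by N^3, p_2 of the centred nodes is the mean of x^2 minus the square of the mean
   of x. *)
rewrite (_ : (fun t => _) = (fun t => (n t).+1%:R^-1 * (\sum_(i < (n t).+1) x t i ^+ 2)
   - ((n t).+1%:R^-1 * \sum_(i < (n t).+1) x t i) ^+ 2)); first exact: cvgB.
apply/funext => t /=; rewrite /psum (sum_nodes t (fun a => a ^+ 2)) -/(N t).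
have -> : \sum_(i < (n t).+1) (N t * x t i - mean_shifted t) ^+ 2
  = N t ^+ 2 * \sum_(i < (n t).+1) x t i ^+ 2 - 2 * N t * mean_shifted t * \sum_(i <
    (n t).+1) x t i
    + N t * mean_shifted t ^+ 2.
  have -> : N t * mean_shifted t ^+ 2 = \sum_(i < (n t).+1) mean_shifted t ^+ 2.
    by rewrite sumr_const card_ord -[_ *+ _]mulr_natl.
  by rewrite !mulr_sumr -sumrB -big_split /=; apply: eq_bigr => i _; ring.
rewrite -mE; have := lt0r_neq0 (N0 t); move: (N t) (mean_shifted t) (\sum_(i < _) _)
  => M a b M0.
by field.
Qed.
End Approximation.
End Profiles.

(** * Uniform convergence and induction on the number of variables *)

Section CLT.
Variable R : realType.
Local Notation int01 f := (\int[@lebesgue_measure R]_(t in `[0, 1]) (f t)).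

Lemma approximates_zero (T : Type) (F : set_system T) (FF : Filter F) (n : T -> nat) :
  n @ F --> \oo -> approximates F n (fun _ _ => 0) (fun=> 0 : R).
Proof.
move=> ninf; split => //.
- exact: filterE.
- move=> e e0; apply: filterE => t; rewrite big1 ?mulr_ge0 ?(ltW e0) // => i _.
  by rewrite mul0r subrr normr0.
- by exists 0; apply: filterE => t i _; rewrite normr0 mul0r.
Qed.

(** The two centres differ by |lambda| / N. Subtracting E(f) N y from y |lambda| / N leaves (y sqrt
    N) sqrt N (|lambda| / N^2 - E(f)), which vanishes by [mean_cvg]; the ratio of the two series
    gives the limit. *)
Lemma schur_one_var_cvg (T : Type) (F : set_system T) (FF : Filter F) (n : T -> nat)
    (lam : T -> nat -> int) (f : R -> R) (y : T -> R) (c : R) :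
  weakly_decreasing f -> approximates F n lam f ->
  y t * Num.sqrt (n t).+1%:R @[t --> F] --> c ->
  GT (n t).+1 (lam t) (first_var (expR (y t))) / GT (n t).+1 (lam t) (fun=> 1)
    * expR (- (Ef f * (n t).+1%:R * y t)) @[t --> F] --> expR (Sf f / 2 * c ^+ 2).
Proof.
move=> fd lf cy; have [ninf dl _ _] := lf.
have zd : weakly_decreasing (fun=> 0 : R) by [].
have lz := approximates_zero FF ninf.
have [v [nv cv]] := simplex_nodes_limit fd lf cy.
have [v0 [nv0 cv0]] := simplex_nodes_limit zd lz cy.
have cm := @mean_cvg _ _ _ FF _ _ _ fd lf.
pose N t : R := (n t).+1%:R.
have N0 t : N t != 0 by rewrite pnatr_eq0.
have key : {near F, (fun t => expR ((y t * Num.sqrt (N t)) *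
     (Num.sqrt (N t) * ((weight (n t).+1 (lam t))%:~R / N t ^+ 2 - int01 f))) * (v t /
       v0 t))
  =1 (fun t => GT (n t).+1 (lam t) (first_var (expR (y t))) / GT (n t).+1 (lam t)
    (fun=> 1)
    * expR (- (Ef f * (n t).+1%:R * y t)))}.
  apply: filterS3 dl nv nv0 => t dl nv nv0.
  rewrite (schur_one_var dl nv nv0) [RHS]mulrAC -expRD; congr (expR _ * _).
  have -> : mean_shifted R n lam t - mean_shifted R n (fun _ _ => 0) t
     = (weight (n t).+1 (lam t))%:~R / N t.
    rewrite /mean_shifted -mulrBl -sumrB /weight rmorph_sum /=; congr (_ / _).
    by apply: eq_bigr => i _; rewrite /shifted !rmorphD /= add0r addrK.
  rewrite -/(Ef f) -/(N t).
  have -> : y t * Num.sqrt (N t) * (Num.sqrt (N t) * ((weight (n t).+1 (lam t))%:~R /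
    N t ^+ 2 - Ef f))
    = y t * Num.sqrt (N t) ^+ 2 * ((weight (n t).+1 (lam t))%:~R / N t ^+ 2 - Ef f)
      by ring.
  rewrite sqr_sqrtr ?ler0n //; have := N0 t; move: (N t) => M M0; by field.
apply: cvg_trans (near_eq_cvg key) _.
have -> : expR (Sf f / 2 * c ^+ 2) = expR (c * 0) * (expR (c ^+ 2 * profile_var f / 2) /
    expR (c ^+ 2 * profile_var (fun=> 0 : R) / 2)).
  rewrite mulr0 expR0 mul1r -expRN -expRD; congr expR;
    rewrite (Sf_var fd) -/(profile_var f).
  have -> : profile_var (fun=> 0 : R) = int01 (fun t => (1 - t) ^+ 2) - (int01 (fun t
    => 1 - t)) ^+ 2.
    rewrite /profile_var; congr (_ - _ ^+ 2); by apply: eq_Rintegral => t _;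
      rewrite add0r.
  by field.
apply: cvgM; last by apply: cvgM => //; apply: cvgV => //; rewrite gt_eqF // expR_gt0.
have h : (y t * Num.sqrt (N t)) * (Num.sqrt (N t) *
    ((weight (n t).+1 (lam t))%:~R / N t ^+ 2 - int01 f)) @[t --> F] --> c * 0
      by exact: (cvgM cy cm).
by apply: (cvg_comp _ (@expR R) h); exact: continuous_expR.
Qed.

(* Points are pairs (t, mu) with mu interlacing lam t, so that convergence
   along this filter is convergence uniform in mu. *)
Definition interlacing_filter (T : Type) (F : set_system T) (n : T -> nat)
    (lam : T -> nat -> int) : set_system (T * (nat -> int)) :=
  [set A | \forall t \near F, forall d, d \in interlacing (n t) (lam t) ->
      A (t, lowering (lam t) d)].

Lemma interlacing_filter_filter (T : Type) (F : set_system T) (FF : Filter F) n lam :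
  Filter (interlacing_filter F n lam).
Proof.
pose P A t := forall d, d \in interlacing (n t) (lam t) ->
  A (t, lowering (lam t) d) : Prop.
split; rewrite /interlacing_filter /= /prop_near1.
- exact: (@filterE _ F).
- move=> A B hA hB; apply: (@filterS2 T F FF (P A) (P B) _ _ hA hB) => t {}hA {}hB d Hd.
  by split; [exact: hA|exact: hB].
- move=> A B AB hA; apply: (@filterS T F FF (P A) (P B) _ hA) => t {}hA d Hd.
  by apply: AB; exact: hA.
Qed.

Lemma near_interlacing (T : Type) (F : set_system T) n lam (A : T * (nat -> int) ->
  Prop) :
  (\forall t \near F, forall d, d \in interlacing (n t) (lam t) ->
     A (t, lowering (lam t) d)) ->
  \forall p \near interlacing_filter F n lam, A p.
Proof. by []. Qed.

Lemma cvg_fst_interlacing (T : Type) (F : set_system T) (FF : Filter F) n lam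
    (U : topologicalType) (g : T -> U) (l : U) :
  g @ F --> l -> (fun p : T * (nat -> int) => g p.1) @ (interlacing_filter F n lam) --> l.
Proof.
move=> gl A /gl gA.
by apply: (@filterS T F FF (g @^-1` A)
  (fun t => forall d, d \in interlacing (n t) (lam t) -> A (g t)) _ gA).
Qed.

(** The grids interlace: (i+1)/(n+2) <= (i+1)/(n+1) <= (i+2)/(n+2). So each term is at most a
    difference of neighbouring values on the finer grid, and these telescope. *)
Lemma profile_shift_sum (f : R -> R) n : weakly_decreasing f ->
  \sum_(i < n.+1) `|f (i.+1%:R / n.+2%:R) - f (i.+1%:R / n.+1%:R)| <= f 0 - f 1.
Proof.
move=> fd.
have inI (a b : nat) : (a <= b.+1)%N -> (a%:R / b.+1%:R : R) \in `[0, 1].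
  by move=> ab; rewrite in_itv /= divr_ge0 //= ler_pdivrMr ?ltr0n // mul1r ler_nat.
have term (i : 'I_n.+1) : `|f (i.+1%:R / n.+2%:R) - f (i.+1%:R / n.+1%:R)|
    <= - f (i.+2%:R / n.+2%:R) - (- f (i.+1%:R / n.+2%:R)).
  have h1 : f (i.+1%:R / n.+1%:R) <= f (i.+1%:R / n.+2%:R).
    apply: fd; [by apply: inI; have := ltn_ord i; lia..|].
    by rewrite ler_wpM2l // lef_pV2 ?posrE ?ltr0n // ler_nat.
  have h2 : f (i.+2%:R / n.+2%:R) <= f (i.+1%:R / n.+1%:R).
    apply: fd; [by apply: inI; have := ltn_ord i; lia..|].
    rewrite ler_pdivrMr ?ltr0n // mulrAC ler_pdivlMr ?ltr0n // -!natrM ler_nat.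
    by have := ltn_ord i; nia.
  by rewrite ger0_norm ?subr_ge0 //; lra.
rewrite (le_trans (ler_sum _ (fun i _ => term i))) //.
rewrite -(big_mkord xpredT (fun i => - f (i.+2%:R / n.+2%:R) - (- f (i.+1%:R /
  n.+2%:R)))).
rewrite (telescope_sumr (fun i => - f (i.+1%:R / n.+2%:R))) // divff ?pnatr_eq0 //.
have : f (1%:R / n.+2%:R) <= f 0.
  apply: fd; last by rewrite divr_ge0.
    by rewrite in_itv /= lexx ler01.
  exact: (inI 1%N n.+1).
by lra.
Qed.

Lemma lowering_norm m (lam : nat -> int) (d : {ffun 'I_m ->
  'I_(gap_bound m lam)}) (C : R) i :
  is_sig m.+1 lam -> d \in interlacing m lam ->
  (forall j, (j < m.+1)%N -> `|(lam j)%:~R : R| <= C) -> (i < m)%N ->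
  `|(lowering lam d i)%:~R : R| <= C.
Proof.
move=> dl Hd lC im; have /andP[h1 h2] := lowering_bounds dl Hd im.
have := lC i (ltnW im); have := lC i.+1 im.
rewrite !ler_norml => /andP[a1 _] /andP[_ b2]; apply/andP; split.
  by rewrite (le_trans a1) // ler_int.
by rewrite (le_trans _ b2) // ler_int.
Qed.

(** Triangle inequality through four changes: of the denominator (cost C), from the interlacing
    signature to [lam] (2C, by telescoping), of the number of summands (free), and of the grid (f 0
    - f 1). *)
Lemma lowering_profile_sum m (lam : nat -> int) (d : {ffun 'I_m.+1 ->
  'I_(gap_bound m.+1 lam)})
    (f : R -> R) (C : R) :
  weakly_decreasing f -> is_sig m.+2 lam -> d \in interlacing m.+1 lam ->
  (forall j, (j < m.+2)%N -> `|(lam j)%:~R : R| <= C * m.+2%:R) ->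
  \sum_(i < m.+1) `|(lowering lam d i)%:~R / m.+1%:R - f (i.+1%:R / m.+1%:R)|
  <= 3 * C + (f 0 - f 1)
     + \sum_(i < m.+2) `|(lam i)%:~R / m.+2%:R - f (i.+1%:R / m.+2%:R)|.
Proof.
move=> fd dl Hd lC; set mu := lowering lam d.
pose M : R := m.+2%:R; pose n : R := m.+1%:R.
have M0 : 0 < M by rewrite ltr0n.
have n0 : 0 < n by rewrite ltr0n.
have nM : M = n + 1 by rewrite /M /n natr1.
have C0 : 0 <= C.
  by have := lC 0%N isT; rewrite -/M => h; rewrite -(pmulr_lge0 _ M0); apply: le_trans h.
have s1 : \sum_(i < m.+1) `|(mu i)%:~R / n - (mu i)%:~R / M| <= C.
  apply: (@le_trans _ _ (\sum_(i < m.+1) C / n)); last first.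
    by rewrite sumr_const card_ord -[_ *+ _]mulr_natr -/n divfK // gt_eqF.
  apply: ler_sum => i _.
  have h := lowering_norm dl Hd lC (ltn_ord i).
  have -> : (mu i)%:~R / n - (mu i)%:~R / M = (mu i)%:~R / (n * M).
    rewrite nM in M0 *; field; by rewrite ?gt_eqF.
  rewrite normrM normfV [`|n * M|]gtr0_norm ?mulr_gt0 // ler_pdivrMr ?mulr_gt0 //.
  by rewrite mulrA divfK ?gt_eqF.
have s2 : \sum_(i < m.+1) `|(mu i)%:~R / M - (lam i)%:~R / M| <= 2 * C.
  apply: (@le_trans _ _ (\sum_(i < m.+1) ((- (lam i.+1)%:~R / M) - (- (lam i)%:~R / M)))).
    apply: ler_sum => i _; have /andP[h1 h2] := lowering_bounds dl Hd (ltn_ord i).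
    rewrite distrC -mulrBl normrM normfV [`|M|]gtr0_norm // -mulrBl ler_pM2r ?invr_gt0 //.
    move: h1 h2; rewrite -(ler_int R) -/mu => h1; rewrite -(ler_int R) => h2.
    by rewrite ger0_norm ?subr_ge0 //; lra.
  rewrite -(big_mkord xpredT (fun i => (- (lam i.+1)%:~R / M) - (- (lam i)%:~R / M))).
  rewrite (telescope_sumr (fun i => - (lam i)%:~R / M)) // -mulrBl ler_pdivrMr //.
  have := lC 0%N isT; have := lC m.+1 (ltnSn _); rewrite -/M !ler_norml.
  by move=> /andP[? ?] /andP[? ?]; lra.
have s4 := profile_shift_sum m fd.
have s3 : \sum_(i < m.+1) `|(lam i)%:~R / M - f (i.+1%:R / M)|
    <= \sum_(i < m.+2) `|(lam i)%:~R / M - f (i.+1%:R / M)|.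
  by rewrite [leRHS]big_ord_recr /= lerDl.
apply: (@le_trans _ _ (\sum_(i < m.+1) (`|(mu i)%:~R / n - (mu i)%:~R / M| +
   `|(mu i)%:~R / M - (lam i)%:~R / M| + `|(lam i)%:~R / M - f (i.+1%:R / M)|
   + `|f (i.+1%:R / M) - f (i.+1%:R / n)|))).
  apply: ler_sum => i _; rewrite -/n.
  have -> : (mu i)%:~R / n - f (i.+1%:R / n) = ((mu i)%:~R / n - (mu i)%:~R / M) +
   ((mu i)%:~R / M - (lam i)%:~R / M) + ((lam i)%:~R / M - f (i.+1%:R / M))
   + (f (i.+1%:R / M) - f (i.+1%:R / n)) by ring.
  by rewrite !(le_trans (ler_normD _ _)) // ?lerD // !(le_trans (ler_normD _ _)) //
    ?lerD // ler_normD.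
rewrite !big_split /= -/M.
by move: s1 s2 s3 s4; rewrite -/M -/n; lra.
Qed.

Lemma approximates_lowering (T : Type) (F : set_system T) (FF : Filter F) (n : T -> nat)
    (lam : T -> nat -> int) (f : R -> R) :
  weakly_decreasing f -> approximates F n lam f ->
  approximates (interlacing_filter F n lam) (fun p => (n p.1).-1) (fun p => p.2) f.
Proof.
move=> fd [ninf dl lamf [C lamC]].
have FF' := interlacing_filter_filter FF n lam.
have npos : \forall t \near F, (1 <= n t)%N by move/cvgnyPge : ninf => /(_ 1%N).
have sqrt_inf (e K : R) : 0 < e -> \forall t \near F, K <= e * Num.sqrt (n t)%:R.
  move=> e0; have h : \forall t \near F, ((Num.truncn ((K / e) ^+ 2)).+1 <= n t)%N.
    by move/cvgnyPge : ninf; apply.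
  apply: filterS h => t h; rewrite mulrC -ler_pdivrMr //.
  rewrite (le_trans (ler_norm _)) // -sqrtr_sqr ler_wsqrtr //.
  by rewrite (le_trans (ltW (truncnS_gt _))) // ler_nat.
split.
- apply/cvgnyPge => A.
  have h : \forall t \near F, (A.+1 <= n t)%N by move/cvgnyPge : ninf; apply.
  by apply: near_interlacing; apply: (@filterS T F FF _ _ _ h) => t {}h d _ /=;
    rewrite -ltnS prednK // (leq_trans _ h).
- apply: near_interlacing; apply: (@filterS2 T F FF _ _ _ _ npos dl) => t np dlt d Hd
    /=; rewrite prednK //.
  exact: is_sig_lowering.
(* The constant is eventually below e/2 sqrt n, and e/4 sqrt (n+1) <= e/2 sqrt n because n + 1 <= 4
   n. *)
- move=> e e0; have e4 : 0 < e / 4 by rewrite divr_gt0.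
  have h := sqrt_inf (e / 2) (3 * C + (f 0 - f 1)) ltac:(by rewrite divr_gt0).
  have {}lamf := lamf _ e4.
  have k1 : \forall t \near F, (1 <= n t)%N /\ is_sig (n t).+1 (lam t)
    by apply: filterS2 npos dl.
  have k2 : \forall t \near F, 3 * C + (f 0 - f 1) <= e / 2 * Num.sqrt (n t)%:R /\
      \sum_(i < (n t).+1) `|(lam t i)%:~R / (n t).+1%:R - f (i.+1%:R / (n t).+1%:R)|
        <= e / 4 * Num.sqrt (n t).+1%:R by apply: filterS2 h lamf.
  apply: near_interlacing; apply: (@filterS3 T F FF _ _ _ _ _ k1 k2 lamC).
  move=> t [np dlt] [l2 l1] lC d Hd /=.
  move: l1 l2 dlt lC d Hd; case: (n t) np => // m _ l1 l2 dlt lC d Hd /=.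
  rewrite (le_trans (lowering_profile_sum fd dlt Hd lC)) //.
  have -> : e * Num.sqrt m.+1%:R = e / 2 * Num.sqrt m.+1%:R
    + e / 4 * (2 * Num.sqrt m.+1%:R).
    by field.
  rewrite lerD // (le_trans l1) // ler_wpM2l ?(ltW e4) //.
  have -> : 2 * Num.sqrt m.+1%:R = Num.sqrt (2 ^+ 2 * m.+1%:R) :> R.
    by rewrite sqrtrM ?exprn_ge0 // sqrtr_sqr ger0_norm.
  rewrite ler_wsqrtr //.
  by rewrite -natrX -natrM ler_nat; lia.
(* n + 1 <= 2 n converts the bound relative to size n + 1 into one relative to size n. *)
- exists (C * 2).
  apply: near_interlacing; apply: (@filterS3 T F FF _ _ _ _ _ npos dl lamC) => t np
    dlt lC d Hd i /=; rewrite prednK // => iN.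
  rewrite (le_trans (lowering_norm dlt Hd lC iN)) // -mulrA.
  have C0 : 0 <= C.
    have M0 : 0 < (n t).+1%:R :> R by rewrite ltr0n.
    by have h := lC 0%N isT; rewrite -(pmulr_lge0 _ M0); apply: le_trans h.
  by rewrite ler_wpM2l // -natrM ler_nat; lia.
Qed.

End CLT.

(** * Several variables *)

Section MultiCLT.
Variable R : realType.

(** The first quotient averages the inner ones with nonnegative weights whose total is the
    one-variable quotient, so an error [e] in each inner quotient is multiplied by at most that
    total. *)
Lemma branching_perturbation n (lam : nat -> int) (x : R) (w : nat -> R) (s L e : R) :
  0 < x ->
  (forall d, d \in interlacing n lam ->
     `|L - GT n (lowering lam d) w / GT n (lowering lam d) (fun=> 1) * s| <= e) ->
  `|GT n.+1 lam (cons_var x w) / GT n.+1 lam (fun=> 1) * s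
    - GT n.+1 lam (first_var x) / GT n.+1 lam (fun=> 1) * L|
  <= e * (GT n.+1 lam (first_var x) / GT n.+1 lam (fun=> 1)).
Proof.
move=> x0 H; set G := GT n.+1 lam (fun=> 1).
have G0 : 0 < G by exact: GT_gt0.
pose p (d : {ffun 'I_n -> 'I_(gap_bound n lam)}) := x ^ (weight n.+1 lam - weight n
  (lowering lam d)) * GT n (lowering lam d) (fun=> 1) / G : R.
have p0 d : 0 <= p d.
  by rewrite !mulr_ge0 ?invr_ge0 ?exprz_ge0 ?ltW // GT_gt0.
have E1 : GT n.+1 lam (first_var x) / G = \sum_(d in interlacing n lam) p d.
  by rewrite GTS mulr_suml.
have E2 : GT n.+1 lam (cons_var x w) / G * s = \sum_(d in interlacing n lam)
    p d * (GT n (lowering lam d) w / GT n (lowering lam d) (fun=> 1) * s).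
  rewrite GTS !mulr_suml; apply: eq_bigr => d _.
  have : GT n (lowering lam d) (fun=> 1) != 0 :> R by rewrite gt_eqF // GT_gt0.
  rewrite /p /=; move: (GT n _ (fun=> 1)) => g g0.
  by have Gn := lt0r_neq0 G0; field; rewrite g0 Gn.
rewrite E1 E2 mulr_suml -sumrB mulr_sumr (le_trans (ler_norm_sum _ _ _)) //.
apply: ler_sum => d Hd; rewrite -mulrBr normrM ger0_norm // mulrC ler_wpM2r //.
by rewrite distrC H.
Qed.

(** The induction on [k] ranges over all types and filters, because the hypothesis is used along
    [interlacing_filter], where signatures have one entry fewer. *)
Lemma schur_multi_cvg k (T : Type) (F : set_system T) (FF : Filter F) (n : T -> nat)
    (lam : T -> nat -> int) (f : R -> R) (y : nat -> T -> R) (c : nat -> R) :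
  weakly_decreasing f -> approximates F n lam f ->
  (forall j, (j < k)%N -> y j t * Num.sqrt (n t).+1%:R @[t --> F] --> c j) ->
  GT (n t).+1 (lam t) (fun i => if (i < k)%N then expR (y i t) else 1)
    / GT (n t).+1 (lam t) (fun=> 1)
    * expR (- (Ef f * (n t).+1%:R * \sum_(j < k) y j t)) @[t --> F] -->
  expR (Sf f / 2 * \sum_(j < k) c j ^+ 2).
Proof.
move=> fd; elim: k T F FF n lam y c => [|k IH] T F FF n lam y c lf cy.
  rewrite big_ord0 mulr0 expR0; apply: cvg_near_cst; apply: filterE => t.
  rewrite big_ord0 mulr0 oppr0 expR0 mulr1.
  have -> : GT (n t).+1 (lam t) (fun i => if (i < 0)%N then expR (y i t) else 1)
     = GT (n t).+1 (lam t) (fun=> 1) by exact: GT_eq.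
  by rewrite divff // gt_eqF // GT_gt0.
have [ninf dl _ _] := lf.
have npos : \forall t \near F, (1 <= n t)%N by move/cvgnyPge : ninf => /(_ 1%N).
pose N t : R := (n t).+1%:R.
have sN0 t : 0 < Num.sqrt (N t) by rewrite sqrtr_gt0 ltr0n.
have cinv : (Num.sqrt (N t))^-1 @[t --> F] --> (0 : R) by exact: cvg_inv_sqrtN.
(* This converts sqrt N into the sqrt (N - 1) that the induction hypothesis asks for. *)
have sq1 : Num.sqrt ((n t)%:R / N t) @[t --> F] --> (1 : R).
  have h : (n t)%:R / N t @[t --> F] --> (1 : R).
    have : 1 - (N t)^-1 @[t --> F] --> (1 - 0 : R).
      by apply: cvgB; [exact: cvg_cst|exact: cvg_invN].
    rewrite subr0 (_ : (fun t => 1 - _) = (fun t => (n t)%:R / N t)) //.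
    apply/funext => t; have M0 : N t != 0 by rewrite pnatr_eq0.
    by apply: (mulIf M0); rewrite mulrBl mulVf // divfK // mul1r /N -natr1 addrK.
  suff : Num.sqrt ((n t)%:R / N t) @[t --> F] --> Num.sqrt (1 : R) by rewrite sqrtr1.
  by apply: (cvg_comp _ (@Num.sqrt R) h); exact: sqrt_continuous.
have y0 j : (j < k.+1)%N -> y j @ F --> (0 : R).
  move=> jk; rewrite (_ : y j = (fun t => y j t * Num.sqrt (N t) * (Num.sqrt (N t))^-1)).
    by have := cvgM (cy j jk) cinv; rewrite mulr0; apply.
  apply/funext => t.
  by rewrite -mulrA divff ?mulr1 // gt_eqF.
pose y' j (p : T * (nat -> int)) := y j.+1 p.1.
have cy' j : (j < k)%N -> y' j p * Num.sqrt (n p.1).-1.+1%:R @[p -->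
  interlacing_filter F n lam] --> c j.+1.
  move=> jk; apply: (@cvg_fst_interlacing T F FF n lam _ (fun t => y j.+1 t * Num.sqrt
    (n t).-1.+1%:R)).
  have h : y j.+1 t * Num.sqrt (N t) * Num.sqrt ((n t)%:R / N t) @[t --> F] --> c j.+1
    * 1.
    by apply: cvgM => //; exact: cy.
  rewrite mulr1 in h.
  have key : {near F, (fun t => y j.+1 t * Num.sqrt (N t) * Num.sqrt ((n t)%:R / N t))
      =1 (fun t => y j.+1 t * Num.sqrt (n t).-1.+1%:R)};
        last exact: cvg_trans (near_eq_cvg key) h.
  apply: filterS npos => t np; rewrite prednK // -mulrA; congr (_ * _);
    rewrite -sqrtrM ?ler0n //.
  by rewrite mulrC divfK // pnatr_eq0.
have FF' := interlacing_filter_filter FF n lam.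
have {}IH := IH _ _ FF' _ _ y' (fun j => c j.+1) (approximates_lowering FF fd lf) cy'.
set L := expR (_ * \sum_(j < k) _) in IH.
pose L1 := expR (Sf f / 2 * c 0%N ^+ 2).
(* The last factor is 1, written as the limit of e^(- E(f) Y): the induction hypothesis normalises
   by N - 1 instead of N, and this is the missing factor. *)
have -> : expR (Sf f / 2 * \sum_(j < k.+1) c j ^+ 2) = L1 * L * expR (- (Ef f * 0)).
  by rewrite big_ord_recl mulrDr expRD mulr0 oppr0 expR0 mulr1.
pose Y t := \sum_(j < k) y j.+1 t.
have Y0 : Y @ F --> (0 : R).
  rewrite (_ : 0 = \sum_(j < k) (0 : R)); last by rewrite big1.
  by apply: cvg_fin_sum => j; apply: y0; exact: (ltn_ord j).
pose W t i := if (i < k)%N then expR (y i.+1 t) else 1 : R.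
pose Q t := GT (n t).+1 (lam t) (first_var (expR (y 0%N t))) / GT (n t).+1 (lam t)
  (fun=> 1)
    * expR (- (Ef f * N t * y 0%N t)).
have cQ : Q @ F --> L1 by apply: schur_one_var_cvg => //; exact: cy.
have Q0 t : 0 <= Q t.
  rewrite mulr_ge0 ?divr_ge0 ?expR_ge0 // ltW // GT_gt0 // => -[|i] _ //.
  exact: expR_gt0.
pose Z t := GT (n t).+1 (lam t) (cons_var (expR (y 0%N t)) (W t)) / GT (n t).+1 (lam
  t) (fun=> 1)
    * expR (- (Ef f * (n t)%:R * Y t)) * expR (- (Ef f * N t * y 0%N t)).
have cZ : Z @ F --> L1 * L.
  have cQL : Q t * L @[t --> F] --> L1 * L by apply: cvgMr_tmp.
  suff cd : (fun t => Z t - Q t * L) @ F --> (0 : R).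
    rewrite (_ : Z = (fun t => (Z t - Q t * L) + Q t * L)).
      by rewrite -[L1 * L]add0r; apply: cvgD.
    by apply/funext => t; rewrite subrK.
  apply/cvgrPdist_le => e e0.
  (* [Q] is eventually at most L1 + 1, so accuracy e / (L1 + 1) in the inner quotients suffices. *)
  have L10 : 0 < L1 + 1 by rewrite addr_gt0 ?expR_gt0.
  have e1 : 0 < e / (L1 + 1) by rewrite divr_gt0.
  have QB : \forall t \near F, Q t <= L1 + 1.
    have /cvgrPdist_le /(_ 1 ltr01) := cQ; apply: filterS => t H.
    by rewrite -lerBlDl; apply: le_trans H; rewrite distrC; exact: ler_norm.
  have IHe : \forall t \near F, forall d, d \in interlacing (n t) (lam t) ->
     `|L - GT (n t).-1.+1 (lowering (lam t) d) (W t) / GT (n t).-1.+1 (lowering (lam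
       t) d) (fun=> 1)
        * expR (- (Ef f * (n t).-1.+1%:R * Y t))| <= e / (L1 + 1).
    by have /cvgrPdist_le /(_ _ e1) := IH.
  apply: filterS3 npos QB IHe => t np QB IHe; rewrite sub0r normrN.
  rewrite prednK // in IHe.
  have h := branching_perturbation (expR_gt0 (y 0%N t)) IHe.
  rewrite /Z /Q [_ * expR _ * L]mulrAC -mulrBl normrM [`|expR _|]ger0_norm ?expR_ge0 //.
  rewrite (le_trans (ler_wpM2r (expR_ge0 _) h)) // -[leLHS]mulrA -/(Q t).
  by rewrite -[leRHS](divfK (lt0r_neq0 L10)) ler_wpM2l ?(ltW e1).
have cE : expR (- (Ef f * Y t)) @[t --> F] --> expR (- (Ef f * 0)).
  have h : - (Ef f * Y t) @[t --> F] --> - (Ef f * 0) by apply: cvgN; apply: cvgMl_tmp.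
  by apply: (cvg_comp _ (@expR R) h); exact: continuous_expR.
have key : {near F, (fun t => Z t * expR (- (Ef f * Y t))) =1 (fun t =>
    GT (n t).+1 (lam t) (fun i => if (i < k.+1)%N then expR (y i t) else 1)
    / GT (n t).+1 (lam t) (fun=> 1)
    * expR (- (Ef f * (n t).+1%:R * \sum_(j < k.+1) y j t)))};
  last exact: cvg_trans (near_eq_cvg key) (cvgM cZ cE).
apply: filterE => t.
have -> : (fun i => if (i < k.+1)%N then expR (y i t) else 1)
    = cons_var (expR (y 0%N t)) (W t) by apply/funext => -[].
rewrite /Z -[LHS]mulrA -[LHS]mulrA; congr (_ * _); rewrite -!expRD; congr expR.
rewrite big_ord_recl -/(Y t) -/(N t).
have -> : (n t)%:R = N t - 1 by rewrite /N -natr1 addrK.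
by ring.
Qed.
End MultiCLT.

Theorem proposition5p8 (R : realType) (lam : forall N : nat, 'I_N -> int)
  (f : R -> R)
  (lam_sig : forall N : nat, signature (lam N))
  (f_nonconst : nonconstant f)
  (f_pdiff : piecewise_differentiable f)
  (f_decr : weakly_decreasing f)
  (lam_f : (fun N : nat =>
      \sum_(i < N) `|(lam N i)%:~R / N%:R - f (i.+1%:R / N%:R)|)
    =o_\oo (fun N : nat => Num.sqrt (N%:R : R)))
  (lam_bounded : exists C : R, forall (N : nat) (i : 'I_N),
      `|(lam N i)%:~R / N%:R| <= C)
  (k : nat) (h : k.-tuple R) :
  (fun N : nat =>
     schur (lam N) (pad1 N [seq expR (x / Num.sqrt (N%:R * Sf f)) | x <- h])
     / schur (lam N) (const_mx 1)
     * expR (- (Num.sqrt N%:R * (Ef f / Num.sqrt (Sf f))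
                * \sum_(j < k) tnth h j)))
  @ \oo --> expR (2^-1 * \sum_(j < k) tnth h j ^+ 2).
Proof.
have S0 := Sf_gt0 f_decr f_nonconst.
have sS0 : 0 < Num.sqrt (Sf f) by rewrite sqrtr_gt0.
pose l (N : nat) : nat -> int := seq_of_fun 0 (lam N).
pose y (j N : nat) : R := nth 0 h j / Num.sqrt (N%:R * Sf f).
pose c (j : nat) : R := nth 0 h j / Num.sqrt (Sf f).
have npos : \forall N \near \oo, (1 <= N)%N by exists 1%N.
(* The size N is written [N.-1.+1], correct for N >= 1, which the limit permits. *)
have app : approximates \oo (fun N => N.-1) l f.
  split.
  - apply/cvgnyPge => A; exists A.+1 => // N /= AN.
    by rewrite -ltnS prednK // (leq_ltn_trans _ AN).
  - apply: filterS npos => N N1; rewrite prednK //; exact: signature_is_sig.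
  - move=> e e0; have /eqoP/(_ _ e0) H := lam_f.
    apply: filterS2 npos H => N N1; rewrite prednK //.
    rewrite ger0_norm ?sumr_ge0 // [`|Num.sqrt _|]ger0_norm ?sqrtr_ge0 //.
    by under eq_bigr => i _ do rewrite -(seq_of_funE 0 (lam N)).
  - have [C lC] := lam_bounded; exists C; apply: filterS npos => N N1 i.
    rewrite prednK // => iN; have N0 : 0 < N%:R :> R by rewrite ltr0n.
    rewrite /l (seq_of_fun_lt _ _ iN); have := lC N (Ordinal iN).
    by rewrite normrM normfV [`|N%:R|]gtr0_norm // ler_pdivrMr.
have cy j : (j < k)%N -> y j N * Num.sqrt N.-1.+1%:R @[N --> \oo] --> c j.
  move=> jk; apply: cvg_near_cst; apply: filterS npos => N N1; rewrite prednK //.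
  have sN0 : 0 < Num.sqrt N%:R :> R by rewrite sqrtr_gt0 ltr0n.
  rewrite /y /c sqrtrM ?ler0n //; field; by rewrite !gt_eqF.
have main := @schur_multi_cvg R k nat \oo eventually_filter _ _ f y c f_decr app cy.
(* Here S(f) c_j^2 = h_j^2, the purpose of the normalisation by sqrt (N S(f)). *)
have -> : expR (2^-1 * \sum_(j < k) tnth h j ^+ 2) =
  expR (Sf f / 2 * \sum_(j < k) c j ^+ 2).
  congr expR; rewrite !mulr_sumr; apply: eq_bigr => j _.
  rewrite /c (tnth_nth 0) exprMn exprVn sqr_sqrtr ?ltW //.
  by field; rewrite gt_eqF.
have key : {near \oo, (fun N => GT N.-1.+1 (l N) (fun i => if (i < k)%N then expR (y i
  N) else 1)
       / GT N.-1.+1 (l N) (fun=> 1) * expR (- (Ef f * N.-1.+1%:R * \sum_(j < k) y j N)))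
   =1 (fun N => schur (lam N) (pad1 N [seq expR (x / Num.sqrt (N%:R * Sf f)) | x <- h])
     / schur (lam N) (const_mx 1)
     * expR (- (Num.sqrt N%:R * (Ef f / Num.sqrt (Sf f)) * \sum_(j < k) tnth h j)))};
  last exact: cvg_trans (near_eq_cvg key) main.
apply: filterS npos => N N1; rewrite prednK //.
have -> : schur (lam N) (const_mx 1) = GT N (l N) (fun=> 1) :> R.
  rewrite schur_GT //; last by move=> i; rewrite mxE.
  by apply: GT_eq => i iN; rewrite (seq_of_fun_lt _ _ iN) mxE.
have padE i : nth 1 [seq expR (x / Num.sqrt (N%:R * Sf f)) | x <- h] i
    = if (i < k)%N then expR (y i N) else 1.
  case: ltnP => ik; first by rewrite (nth_map 0) ?size_tuple.
  by rewrite nth_default // size_map size_tuple.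
have -> : schur (lam N) (pad1 N [seq expR (x / Num.sqrt (N%:R * Sf f)) | x <- h])
    = GT N (l N) (fun i => if (i < k)%N then expR (y i N) else 1).
  rewrite schur_GT //; last first.
    by move=> i; rewrite mxE padE; case: ifP => // _; rewrite expR_gt0.
  (* [GT] reads only the first N variables, which covers the truncation of [pad1] when N < k. *)
  by apply: GT_eq => i iN; rewrite (seq_of_fun_lt _ _ iN) mxE padE.
congr (_ * expR (- _)).
have N0 : 0 < N%:R :> R by rewrite ltr0n.
have sN0 : 0 < Num.sqrt N%:R :> R by rewrite sqrtr_gt0.
rewrite !mulr_sumr; apply: eq_bigr => j _; rewrite /y (tnth_nth 0) sqrtrM ?ler0n //.
rewrite -{1}(sqr_sqrtr (ltW N0)); move: (Num.sqrt N%:R) sN0 => M M0.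
by field; rewrite !gt_eqF.
Qed.
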